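(* Let $1\le m\le n$ be integers, let $A_m,\dots,A_n$ be real constants with $A_mA_n\neq 0$, and let $Y=\sum_{j=m}^nA_jV_j$ be the corresponding linear combination of eigenfunctions of the Sturm-Liouville eigenvalue problem described in the context. Then, counting zeros with multiplicities in the open interval $(\alpha,\beta)$, the function $Y$ (1) has at most $n-1$ zeros, and (2) has at least $m-1$ zeros.
   Context: Let $[\alpha,\beta]\subset(\alpha_0,\beta_0)$ with $\alpha<\beta$, let $K,G,L\in C^\infty((\alpha_0,\beta_0))$ be real-valued with $K,G,L>0$ on $(\alpha_0,\beta_0)$, and let $h,H\in[0,\infty]$. The eigenvalue problem, with spectral parameter $r$, is $$\frac{d}{dx}\Big(K\frac{dV}{dx}\Big)+(rG-L)V=0,\qquad \Big(K\frac{dV}{dx}-hV\Big)(\alpha)=0,\qquad \Big(K\frac{dV}{dx}+HV\Big)(\beta)=0,$$ where $h=\infty$ (resp. $H=\infty$) means the Dirichlet condition $V(\alpha)=0$ (resp. $V(\beta)=0$). It is known (Sturm) that this problem has an increasing infinite sequence $0<\rho_1<\rho_2<\cdots$ of simple eigenvalues tending to infinity; $V_j$ denotes a real eigenfunction associated with $\rho_j$, and $V_j$ vanishes, and changes sign, exactly $j-1$ times in $(\alpha,\beta)$. The multiplicity of a zero $\xi\in(\alpha,\beta)$ of $Y$ is the least $p$ such that $\frac{d^pY}{dx^p}(\xi)\neq 0$. *)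

(* Defs.v *)
From Stdlib Require Import Reals List Arith.
From Coquelicot Require Import Coquelicot.
Open Scope R_scope.

Definition in_open (a b : Rbar) (x : R) : Prop := Rbar_lt a x /\ Rbar_lt x b.

Definition smooth_on (a b : Rbar) (f : R -> R) : Prop :=
  forall (k : nat) (x : R), in_open a b x -> ex_derive_n f k x.

(* Derivative of a function on the closed interval [a, b]: the difference
   quotient only sees points of [a, b], so the derivative is one-sided at a
   and at b and does not depend on the values of f outside [a, b]. *)
Definition is_derive_in (a b : R) (f : R -> R) (x l : R) : Prop :=
  filterlim (fun y => (f y - f x) / (y - x))
    (within (fun y => a <= y <= b) (locally' x)) (locally l).

(* [v] and [dv] are the values of V and dV/dx at the endpoint. *)
Definition left_condition (h : Rbar) (k v dv : R) : Prop :=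
  match h with
  | Finite h' => k * dv - h' * v = 0
  | p_infty => v = 0
  | m_infty => False
  end.

Definition right_condition (H : Rbar) (k v dv : R) : Prop :=
  match H with
  | Finite H' => k * dv + H' * v = 0
  | p_infty => v = 0
  | m_infty => False
  end.

Definition is_eigenfunction (alpha beta : R) (K G L : R -> R) (h H : Rbar)
    (r : R) (V : R -> R) : Prop :=
  (exists x, alpha <= x <= beta /\ V x <> 0) /\
  exists dV : R -> R,
    (forall x, alpha <= x <= beta -> is_derive_in alpha beta V x (dV x)) /\
    (forall x, alpha <= x <= beta ->
       exists d, is_derive_in alpha beta (fun y => K y * dV y) x d /\
                 d + (r * G x - L x) * V x = 0) /\
    left_condition h (K alpha) (V alpha) (dV alpha) /\
    right_condition H (K beta) (V beta) (dV beta).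

Definition is_eigenvalue (alpha beta : R) (K G L : R -> R) (h H : Rbar)
    (r : R) : Prop :=
  exists V, is_eigenfunction alpha beta K G L h H r V.

(* Indices start at 1; the value [rho 0] is irrelevant. *)
Definition enumerates_eigenvalues (alpha beta : R) (K G L : R -> R)
    (h H : Rbar) (rho : nat -> R) : Prop :=
  (forall j, (1 <= j)%nat -> rho j < rho (S j)) /\
  (forall r, is_eigenvalue alpha beta K G L h H r <->
             exists j, (1 <= j)%nat /\ r = rho j).

(* The order p of the first nonvanishing derivative of f at x; the existence
   clause is there because [Derive_n] is a total function. *)
Definition is_multiplicity (f : R -> R) (x : R) (p : nat) : Prop :=
  (forall k, (k <= p)%nat -> ex_derive_n f k x) /\
  (forall k, (k < p)%nat -> Derive_n f k x = 0) /\
  Derive_n f p x <> 0.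

(* f has finitely many zeros in (a, b), each of finite multiplicity, and the
   multiplicities add up to N. *)
Definition number_of_zeros (f : R -> R) (a b : R) (N : nat) : Prop :=
  exists (l : list R) (mu : R -> nat),
    NoDup l /\
    (forall x, In x l <-> a < x < b /\ f x = 0) /\
    (forall x, In x l -> is_multiplicity f x (mu x)) /\
    N = list_sum (map mu l).

(* Main.v *)
Require Import Defs.
From Stdlib Require Import Reals List Arith.
From Coquelicot Require Import Coquelicot.
From Stdlib Require Import ZArith Lra Lia Psatz Permutation Sorted IndefiniteDescription.
From Stdlib Require FinFun.
Open Scope R_scope.

(** The proof is Sturm's.  Write [D] for the map sending the combination of the
    [V j] with coefficients [A j] to the one with coefficients
    [A j * (rho j - rho 1)].

    Applying [D] never loses zeros ([sturm_step]).  Indeed, with [Y] the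
    combination and [W = K (V_1 Y' - Y V_1')], one has [(Y / V_1)' = W / (K V_1^2)]
    and [W' = - G V_1 (D Y)].  If [Y] has [N > 0] zeros, so has [Y / V_1], because
    the first eigenfunction does not vanish inside; Rolle's theorem, counting
    multiplicities, leaves [N - 1] zeros to [W], the boundary conditions add the
    two endpoints, and Rolle's theorem leaves [N] zeros to [W'], hence to [D Y].

    Iterating [D] makes the highest term dominate: [D^i Y], suitably scaled,
    tends to a multiple of [V n] together with its first derivative, and a
    function that is [C^1]-close to [V n] and satisfies the same boundary
    conditions has at most as many zeros as [V n] ([few_zeros_near]).  Iterating
    the inverse of [D] makes the lowest term dominate: close to [V m] there are at
    least as many zeros as [V m] has sign changes ([many_zeros_near]), and [D^i]
    carries them back to [Y].

    There remains Sturm's theorem that [V j] has exactly [j - 1] zeros, where the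
    only information on the [rho j] is that they enumerate the eigenvalues.
    Solutions are written in polar form, [V = p sin theta] and
    [K V' = p cos theta].  The angle solves a scalar equation with a globally
    Lipschitz right-hand side, so Picard iteration yields it for every parameter
    [r]; its value at [beta] is continuous and strictly increasing in [r]; and [r]
    is an eigenvalue exactly when that value is [gam + i * PI] for some natural
    number [i], [gam] being the angle of the right boundary condition.  By the
    intermediate value theorem no [i] is skipped, so [rho j] corresponds to
    [i = j - 1] ([eigenvalue_index], [eigenfunctions_prufer]).  Since the angle
    crosses multiples of [PI] only upwards, this determines the zeros of [V j].

    The coefficients are extended by constants outside the interval ([coefs_clamp]), so that
    the solutions live on the whole line and all derivatives are two-sided; the
    uniqueness theorem [cauchy_problem_unique] identifies them with the given
    eigenfunctions there. *)

(** * Monotonicity, Gronwall's inequality and one-way crossings *)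

Lemma nondecreasing_of_derive_ge0 (f df : R -> R) (a b : R) :
  a <= b ->
  (forall x, a <= x <= b -> continuity_pt f x) ->
  (forall x, a < x < b -> is_derive f x (df x)) ->
  (forall x, a < x < b -> 0 <= df x) -> f a <= f b.
Proof.
  intros Hab Hc Hd Hp.
  (* the mean value point may be an endpoint, where [df] carries no information *)
  set (df' := fun x => if Rlt_dec a x then if Rlt_dec x b then df x else 0 else 0).
  destruct (MVT_gen f a b df') as [c [_ Hc']].
  - rewrite Rmin_left, Rmax_right by lra. intros x Hx. unfold df'.
    destruct (Rlt_dec a x); [|lra]. destruct (Rlt_dec x b); [|lra]. now apply Hd.
  - rewrite Rmin_left, Rmax_right by lra. auto.
  - assert (0 <= df' c).
    { unfold df'. destruct (Rlt_dec a c); [|lra]. destruct (Rlt_dec c b); [|lra].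
      apply Hp; lra. }
    nra.
Qed.

Lemma is_derive_continuity_pt (f : R -> R) (x l : R) :
  is_derive f x l -> continuity_pt f x.
Proof.
  intros H. apply derivable_continuous_pt. exists l. now apply is_derive_Reals.
Qed.

Lemma gronwall (f df : R -> R) (C a b : R) :
  a <= b ->
  (forall x, a <= x <= b -> continuity_pt f x) ->
  (forall x, a < x < b -> is_derive f x (df x)) ->
  (forall x, a < x < b -> df x <= C * f x) ->
  f b <= f a * exp (C * (b - a)).
Proof.
  intros Hab Hc Hd Hle.
  set (w := fun x => exp (- (C * (x - a)))).
  assert (Hw : forall x, is_derive w x (- C * w x)).
  { intros x. unfold w. auto_derive; trivial. unfold Rminus; ring. }
  assert (H := nondecreasing_of_derive_ge0
    (fun x => - (f x * w x)) (fun x => - (df x * w x + f x * (- C * w x))) a b Hab).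
  assert (H' : - (f a * w a) <= - (f b * w b)).
  { apply H.
    - intros x Hx. apply continuity_pt_opp, continuity_pt_mult; auto.
      eapply is_derive_continuity_pt, Hw.
    - intros x Hx. apply (is_derive_opp (fun x => f x * w x)).
      apply (is_derive_mult f w); auto. intros; apply Rmult_comm.
    - intros x Hx. specialize (Hle x Hx).
      assert (0 < w x) by apply exp_pos. nra. }
  unfold w in H'. replace (- (C * (a - a))) with 0 in H' by ring. rewrite exp_0 in H'.
  rewrite exp_Ropp in H'.
  assert (Hp := exp_pos (C * (b - a))).
  assert (f b * / exp (C * (b - a)) <= f a) by lra.
  apply Rmult_le_reg_r with (/ exp (C * (b - a))). now apply Rinv_0_lt_compat.
  rewrite Rmult_assoc, Rinv_r by lra. lra.
Qed.

Lemma is_derive_pos_local (f : R -> R) (s d : R) :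
  is_derive f s d -> 0 < d ->
  exists e, 0 < e /\ forall x, x <> s -> Rabs (x - s) < e -> 0 < (f x - f s) * (x - s).
Proof.
  intros Hd Hp. apply is_derive_Reals in Hd. destruct (Hd d Hp) as [e He].
  exists e. split; [apply cond_pos|]. intros x Hx Hxe.
  specialize (He (x - s) ltac:(lra) Hxe). replace (s + (x - s)) with x in He by ring.
  apply Rabs_def2 in He. destruct He as [_ He].
  replace ((f x - f s) * (x - s)) with ((f x - f s) / (x - s) * ((x - s) * (x - s)))
    by (field; lra).
  assert (0 < (x - s) * (x - s)) by nra.
  apply Rmult_lt_0_compat; lra.
Qed.

Lemma continuity_pt_eps (f : R -> R) (x e : R) :
  continuity_pt f x -> 0 < e ->
  exists d, 0 < d /\ forall y, Rabs (y - x) < d -> Rabs (f y - f x) < e.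
Proof.
  intros H He. destruct (H e He) as [d [Hd Hdd]]. exists d. split; trivial.
  intros y Hy. destruct (Req_dec x y) as [<-|N].
  - rewrite Rminus_diag, Rabs_R0; trivial.
  - apply (Hdd y). split; [split; [exact I|trivial]|exact Hy].
Qed.

(** Since [f] increases through the level wherever it meets it, it cannot come back to it from above.
Multiples of [PI] are passed in this way by Prufer angles. *)
Lemma crossing_up (f df : R -> R) (c a b : R) :
  a < b -> c <= f a ->
  (forall x, a <= x <= b -> is_derive f x (df x)) ->
  (forall x, a <= x <= b -> f x = c -> 0 < df x) ->
  c < f b.
Proof.
  intros Hab Ha Hd Hp.
  destruct (Rlt_le_dec c (f b)) as [|Hb]; trivial. exfalso.
  (* [b] is left out of the set, so that reaching [b] as its supremum is already absurd when
     [f b = c]: just before [b] the function lies below [c] *)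
  set (E := fun x => a <= x < b /\ c <= f x).
  destruct (completeness E) as [s [Hs1 Hs2]].
  { exists b. intros y [Hy _]. lra. }
  { exists a. split; lra. }
  assert (Has : a <= s) by (apply Hs1; split; lra).
  assert (Hsb : s <= b) by (apply Hs2; intros y [Hy _]; lra).
  assert (Happ : forall e, 0 < e -> exists x, E x /\ s - e < x <= s).
  { intros e He. apply Classical_Prop.NNPP. intros N.
    assert (s <= s - e); [|lra].
    apply Hs2. intros y Hy. destruct (Rle_lt_dec y (s - e)); trivial.
    exfalso. apply N. exists y. auto. }
  assert (Hcont : continuity_pt f s).
  { eapply is_derive_continuity_pt, Hd. lra. }
  assert (Hfs : c <= f s).
  { destruct (Rle_lt_dec c (f s)) as [|G]; trivial. exfalso.
    destruct (continuity_pt_eps f s (c - f s) Hcont) as [d [Hd0 Hdd]]; [lra|].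
    destruct (Happ d Hd0) as [x [[Hx1 Hx2] Hx3]].
    specialize (Hdd x ltac:(apply Rabs_def1; lra)). apply Rabs_def2 in Hdd. lra. }
  assert (Hright : s < b -> exists e, 0 < e /\ forall x, s < x < s + e -> c <= f x).
  { intros Hlt. destruct (Rle_lt_or_eq_dec c (f s) Hfs) as [G|G].
    - destruct (continuity_pt_eps f s (f s - c) Hcont) as [d [Hd0 Hdd]]; [lra|].
      exists d. split; trivial. intros x Hx.
      specialize (Hdd x ltac:(apply Rabs_def1; lra)). apply Rabs_def2 in Hdd. lra.
    - destruct (is_derive_pos_local f s (df s)) as [e [He Hee]]; [apply Hd; lra|apply Hp; lra|].
      exists e. split; trivial. intros x Hx.
      specialize (Hee x ltac:(lra) ltac:(apply Rabs_def1; lra)). nra. }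
  destruct (Rle_lt_or_eq_dec s b Hsb) as [G| ->].
  - destruct (Hright G) as [e [He Hee]].
    set (x := s + Rmin (e / 2) ((b - s) / 2)).
    assert (Rmin (e / 2) ((b - s) / 2) <= e / 2) by apply Rmin_l.
    assert (Rmin (e / 2) ((b - s) / 2) <= (b - s) / 2) by apply Rmin_r.
    assert (0 < Rmin (e / 2) ((b - s) / 2)) by (apply Rmin_glb_lt; lra).
    assert (x <= s); [|unfold x in *; lra].
    apply Hs1. split; [unfold x; lra|]. apply Hee. unfold x; lra.
  - assert (f b = c) as Efb by lra.
    destruct (is_derive_pos_local f b (df b)) as [e [He Hee]]; [apply Hd; lra|apply Hp; lra|].
    destruct (Happ e He) as [x [[Hx1 Hx2] Hx3]].
    specialize (Hee x ltac:(lra) ltac:(apply Rabs_def1; lra)). nra.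
Qed.

(** * Existence for a scalar Lipschitz equation *)

Lemma exp_le_mono x y : x <= y -> exp x <= exp y.
Proof.
  intros [H| ->]; [apply Rlt_le, exp_increasing|]; lra.
Qed.

Section Picard.
Variables (F : R -> R -> R) (x0 t0 B M : R).
Hypothesis HM : 0 < M.
Hypothesis HFc : forall phi : R -> R, (forall s, continuous phi s) ->
  forall s, continuous (fun s => F s (phi s)) s.
Hypothesis HFb : forall s t, Rabs (F s t) <= B.
Hypothesis HFl : forall s t t', Rabs (F s t - F s t') <= M * Rabs (t - t').

Fixpoint picard (n : nat) : R -> R :=
  match n with
  | O => fun _ => t0
  | S n => fun x => t0 + RInt (fun s => F s (picard n s)) x0 x
  end.

(** The weight [w] is symmetric around [x0] and dominates, up to the factor [2 * M],
both its derivative and that of [W]; successive iterates then approach each other geometrically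
with respect to [w] on the whole line, to the left of [x0] as well as to the right. *)
Let w x := exp (2 * M * (x - x0)) + exp (2 * M * (x0 - x)).
Let W x := (exp (2 * M * (x - x0)) - exp (2 * M * (x0 - x))) / 2.

Lemma picard_is_derive_cont (n : nat) :
  (forall x, continuous (picard n) x) /\
  (forall x, is_derive (picard (S n)) x (F x (picard n x))).
Proof.
  assert (D : forall n, (forall x, continuous (picard n) x) ->
    forall x, is_derive (picard (S n)) x (F x (picard n x))).
  { intros j Hj x. simpl.
    assert (Hc := HFc (picard j) Hj).
    replace (F x (picard j x)) with (0 + F x (picard j x)) by ring.
    apply (is_derive_plus (fun _ => t0) (fun x => RInt (fun s => F s (picard j s)) x0 x)).
    apply (@is_derive_const R_AbsRing R_NormedModule).
    apply (is_derive_RInt (fun s => F s (picard j s)) _ x0 x); [|apply Hc].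
    apply filter_forall. intros y. apply (RInt_correct (V := R_CompleteNormedModule)).
    apply (ex_RInt_continuous (V := R_CompleteNormedModule)).
    intros; apply Hc. }
  assert (C : forall n x, continuous (picard n) x).
  { intros j. induction j; intros x.
    - apply continuous_const.
    - apply (ex_derive_continuous (picard (S j)) x). eexists. apply D. trivial. }
  split; auto.
Qed.

(** Since [W' = M * w] and [W] vanishes at [x0], the functions [c * W + d] and [c * W - d] are
nondecreasing and vanish at [x0], so [c * W] dominates [d] in absolute value; and [W] lies between
[- w / 2] and [w / 2]. The factor [1 / 2] gained here makes Picard's iteration a contraction. *)
Lemma picard_comparison (d dd : R -> R) (c : R) :
  0 <= c -> d x0 = 0 -> (forall x, is_derive d x (dd x)) ->
  (forall x, Rabs (dd x) <= c * (M * w x)) -> forall x, Rabs (d x) <= c * w x / 2.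
Proof.
  intros Hc H0 Hd Hb.
  assert (HW : forall x, is_derive W x (M * w x)).
  { intros x. unfold W, w. auto_derive; trivial. unfold Rminus. field. }
  assert (W0 : W x0 = 0). { unfold W. rewrite Rminus_diag. lra. }
  assert (Hmono : forall e, e = 1 \/ e = -1 -> forall x y, x <= y ->
     c * W x + e * d x <= c * W y + e * d y).
  { intros e He x y Hxy.
    apply (nondecreasing_of_derive_ge0 (fun x => c * W x + e * d x)
             (fun x => c * (M * w x) + e * dd x)); trivial.
    - intros z _. eapply is_derive_continuity_pt.
      apply (is_derive_plus (fun x => c * W x) (fun x => e * d x));
      apply is_derive_scal; auto.
    - intros z _. apply (is_derive_plus (fun x => c * W x) (fun x => e * d x));
      apply is_derive_scal; auto.
    - intros z _. specialize (Hb z). apply Rabs_le_between in Hb.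
      destruct He as [->| ->]; lra. }
  intros x.
  assert (H1 := Hmono 1 ltac:(auto)). assert (H2 := Hmono (-1) ltac:(auto)).
  assert (P1 := exp_pos (2 * M * (x - x0))). assert (P2 := exp_pos (2 * M * (x0 - x))).
  assert (K1 : c * W x <= c * w x / 2) by (unfold W, w; nra).
  assert (K2 : - (c * w x / 2) <= c * W x) by (unfold W, w; nra).
  apply Rabs_le_between.
  destruct (Rle_dec x0 x) as [L|L].
  - specialize (H1 _ _ L). specialize (H2 _ _ L). rewrite W0, H0 in *. lra.
  - assert (L' : x <= x0) by lra.
    specialize (H1 _ _ L'). specialize (H2 _ _ L'). rewrite W0, H0 in *. lra.
Qed.

Lemma picard_at_x0 n : picard n x0 = t0.
Proof.
  destruct n; simpl; trivial. rewrite RInt_point. apply Rplus_0_r.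
Qed.

Lemma w_ge1 x : 1 <= w x.
Proof.
  unfold w. assert (H1 := exp_ineq1_le (2 * M * (x - x0))).
  assert (H2 := exp_ineq1_le (2 * M * (x0 - x))). nra.
Qed.

Lemma picard_succ_close n x :
  Rabs (picard (S n) x - picard n x) <= B / M * w x * (/ 2) ^ n.
Proof.
  assert (HB : 0 <= B) by (eapply Rle_trans; [apply Rabs_pos|apply (HFb 0 0)]).
  assert (HBM : 0 <= B / M) by (apply Rle_div_r; lra).
  revert x. induction n; intros x.
  - assert (H := picard_comparison (fun x => picard 1 x - picard 0 x)
       (fun x => F x (picard 0 x)) (B / M) HBM). cbv beta in H.
    rewrite !picard_at_x0, Rminus_diag in H. specialize (H eq_refl).
    assert (Hx : Rabs (picard 1 x - picard 0 x) <= B / M * w x / 2).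
    { apply H.
      - intros y. replace (F y (picard 0 y)) with (F y (picard 0 y) - 0) by ring.
        apply (is_derive_minus (picard 1) (picard 0)).
        apply picard_is_derive_cont. apply (@is_derive_const R_AbsRing R_NormedModule).
      - intros y. eapply Rle_trans. apply HFb.
        assert (Hw := w_ge1 y).
        replace (B / M * (M * w y)) with (B * w y) by (field; lra). nra. }
    assert (Hw := w_ge1 x). simpl pow. nra.
  - assert (Hn : 0 < (/ 2) ^ n) by (apply pow_lt; lra).
    replace (B / M * w x * (/ 2) ^ S n) with (B / M * (/ 2) ^ n * w x / 2) by (simpl; field; lra).
    refine (picard_comparison (fun x => picard (S (S n)) x - picard (S n) x)
       (fun x => F x (picard (S n) x) - F x (picard n x)) (B / M * (/ 2) ^ n) _ _ _ _ x).
    + nra.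
    + rewrite !picard_at_x0. ring.
    + intros y. apply (is_derive_minus (picard (S (S n))) (picard (S n)));
      apply picard_is_derive_cont.
    + intros y. eapply Rle_trans. apply HFl. specialize (IHn y).
      replace (B / M * (/ 2) ^ n * (M * w y)) with (M * (B / M * w y * (/ 2) ^ n)) by ring.
      apply Rmult_le_compat_l; lra.
Qed.

Lemma picard_close n k x :
  Rabs (picard (n + k) x - picard n x) <= 2 * (B / M) * w x * (/ 2) ^ n * (1 - (/ 2) ^ k).
Proof.
  induction k.
  - rewrite Nat.add_0_r, Rminus_diag, Rabs_R0. simpl. lra.
  - replace (n + S k)%nat with (S (n + k)) by lia.
    replace (picard (S (n + k)) x - picard n x) with
      ((picard (S (n + k)) x - picard (n + k) x) + (picard (n + k) x - picard n x)) by ring.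
    eapply Rle_trans. apply Rabs_triang.
    assert (H := picard_succ_close (n + k) x). rewrite pow_add in H. 
    eapply Rle_trans; [apply Rplus_le_compat; [apply H|apply IHk]|]. right. simpl. field. lra.
Qed.

Definition picard_limit x : R := real (Lim_seq (fun n => picard n x)).

Lemma picard_limit_close n x :
  Rabs (picard_limit x - picard n x) <= 2 * (B / M) * w x * (/ 2) ^ n.
Proof.
  assert (HB : 0 <= B) by (eapply Rle_trans; [apply Rabs_pos|apply (HFb 0 0)]).
  assert (HBM : 0 <= B / M) by (apply Rle_div_r; lra).
  assert (Hw := w_ge1 x).
  assert (Hcl : forall n k, Rabs (picard (n + k) x - picard n x) <= 2 * (B / M) * w x * (/ 2) ^ n).
  { intros i k. eapply Rle_trans. apply picard_close.
    assert (0 < (/ 2) ^ i) by (apply pow_lt; lra). assert (0 < (/ 2) ^ k) by (apply pow_lt; lra).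
    assert (0 <= 2 * (B / M) * w x * (/ 2) ^ i).
    { apply Rmult_le_pos; [apply Rmult_le_pos|]; lra. }
    nra. }
  assert (Hlim : ex_finite_lim_seq (fun n => picard n x)).
  { apply ex_lim_seq_cauchy_corr. intros e.
    assert (Hg : is_lim_seq (fun n => 2 * (B / M) * w x * (/ 2) ^ n) 0).
    { replace 0 with (2 * (B / M) * w x * 0) by ring.
      apply (is_lim_seq_scal_l (fun n => (/2)^n) _ 0).
      apply is_lim_seq_geom. rewrite Rabs_pos_eq; lra. }
    apply is_lim_seq_spec in Hg. destruct (Hg (pos_div_2 e)) as [N HN].
    exists N. intros i j Hi Hj.
    specialize (HN N (le_n N)). rewrite Rminus_0_r in HN. apply Rabs_def2 in HN.
    simpl in HN.
    assert (H1 := Hcl N (i - N)%nat). assert (H2 := Hcl N (j - N)%nat).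
    replace (N + (i - N))%nat with i in H1 by lia.
    replace (N + (j - N))%nat with j in H2 by lia.
    apply Rabs_le_between in H1. apply Rabs_le_between in H2. apply Rabs_def1; lra. }
  apply Lim_seq_correct' in Hlim. fold (picard_limit x) in Hlim.
  apply (is_lim_seq_le (fun k => Rabs (picard (n + k) x - picard n x))
     (fun _ => 2 * (B / M) * w x * (/ 2) ^ n)
     (Rabs (picard_limit x - picard n x)) (2 * (B / M) * w x * (/ 2) ^ n)).
  - intros k. apply Hcl.
  - apply (is_lim_seq_abs _ (Finite (picard_limit x - picard n x))).
    apply is_lim_seq_minus'; [|apply is_lim_seq_const].
    apply is_lim_seq_ext with (fun k => picard (k + n) x).
    intros; now rewrite Nat.add_comm. now apply -> (is_lim_seq_incr_n (fun k => picard k x)).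
  - apply is_lim_seq_const.
Qed.

Lemma picard_CVU (c : R) (r : posreal) :
  CVU picard picard_limit c r /\
  CVU (fun n x => F x (picard n x)) (fun x => F x (picard_limit x)) c r.
Proof.
  assert (HB : 0 <= B) by (eapply Rle_trans; [apply Rabs_pos|apply (HFb 0 0)]).
  assert (HBM : 0 <= B / M) by (apply Rle_div_r; lra).
  set (E := exp (2 * M * (c + r - x0)) + exp (2 * M * (x0 - (c - r)))).
  assert (Hw : forall y, Boule c r y -> w y <= E).
  { intros y Hy. apply Rabs_def2 in Hy. unfold w, E.
    apply Rplus_le_compat; apply exp_le_mono; nra. }
  assert (Hcv : forall e, 0 < e -> exists N, forall n y, (N <= n)%nat -> Boule c r y ->
            Rabs (picard_limit y - picard n y) < e).
  { intros e He.
    assert (Hg : is_lim_seq (fun n => 2 * (B / M) * E * (/ 2) ^ n) 0).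
    { replace 0 with (2 * (B / M) * E * 0) by ring.
      apply (is_lim_seq_scal_l (fun n => (/2)^n) _ 0).
      apply is_lim_seq_geom. rewrite Rabs_pos_eq; lra. }
    apply is_lim_seq_spec in Hg. destruct (Hg (mkposreal e He)) as [N HN].
    exists N. intros n y Hn Hy. specialize (HN n Hn). rewrite Rminus_0_r in HN.
    apply Rabs_def2 in HN. simpl in HN. eapply Rle_lt_trans. apply picard_limit_close.
    eapply Rle_lt_trans; [|apply HN].
    apply Rmult_le_compat_r. apply Rlt_le, pow_lt; lra.
    apply Rmult_le_compat_l. lra. now apply Hw. }
  split.
  - intros e He. destruct (Hcv e He) as [N HN]. exists N. auto.
  - intros e He. destruct (Hcv (e / M)) as [N HN]. apply Rdiv_lt_0_compat; lra.
    exists N. intros n y Hn Hy. eapply Rle_lt_trans. apply HFl.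
    replace e with (M * (e / M)) by (field; lra).
    apply Rmult_lt_compat_l; auto.
Qed.

Lemma picard_solves :
  picard_limit x0 = t0 /\ forall x, is_derive picard_limit x (F x (picard_limit x)).
Proof.
  assert (Hcont : forall x, continuous picard_limit x).
  { intros x. apply continuity_pt_filterlim.
    apply (CVU_continuity picard picard_limit x (mkposreal 1 Rlt_0_1)).
    - apply picard_CVU.
    - intros n y _. apply continuity_pt_filterlim. apply picard_is_derive_cont.
    - red. rewrite Rminus_diag, Rabs_R0. simpl; lra. }
  split.
  - unfold picard_limit. rewrite (Lim_seq_ext _ (fun _ => t0)).
    now rewrite Lim_seq_const. intros n; apply picard_at_x0.
  - intros x. apply is_derive_Reals.
    apply (CVU_derivable (fun n => picard (S n)) (fun n x => F x (picard n x))
             picard_limit (fun x => F x (picard_limit x)) x (mkposreal 1 Rlt_0_1)).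
    + apply picard_CVU.
    + intros y Hy. apply is_lim_seq_Reals.
      apply -> (is_lim_seq_incr_1 (fun n => picard n y)).
      apply is_lim_seq_Reals. intros e He.
      destruct (proj1 (picard_CVU x (mkposreal 1 Rlt_0_1)) e He) as [N HN].
      exists N. intros n Hn. unfold R_dist. rewrite Rabs_minus_sym. now apply HN.
    + intros n y _. apply is_derive_Reals. apply picard_is_derive_cont.
    + red. rewrite Rminus_diag, Rabs_R0. simpl; lra.
Qed.
End Picard.

Lemma scalar_ode_exists (F : R -> R -> R) (x0 t0 B M : R) :
  0 < M ->
  (forall phi : R -> R, (forall s, continuous phi s) ->
     forall s, continuous (fun s => F s (phi s)) s) ->
  (forall s t, Rabs (F s t) <= B) ->
  (forall s t t', Rabs (F s t - F s t') <= M * Rabs (t - t')) ->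
  exists theta, theta x0 = t0 /\ forall x, is_derive theta x (F x (theta x)).
Proof.
  intros HM Hc Hb Hl. exists (picard_limit F x0 t0).
  eapply picard_solves; eauto.
Qed.

(** * The Prufer angle *)

Lemma sin_lipschitz t t' : Rabs (sin t - sin t') <= Rabs (t - t').
Proof.
  destruct (MVT_gen sin t' t cos) as [c [_ Hc]].
  - intros x _. apply is_derive_sin.
  - intros x _. apply continuity_sin.
  - rewrite Hc, Rabs_mult. assert (Hb := COS_bound c).
    assert (Rabs (cos c) <= 1) by (apply Rabs_le; lra).
    assert (Hp := Rabs_pos (t - t')). nra.
Qed.

Lemma sin_sq_le1 t : 0 <= sin t ^ 2 <= 1.
Proof. assert (H := SIN_bound t). split; nra. Qed.

Lemma sin_sq_lipschitz t t' : Rabs (sin t ^ 2 - sin t' ^ 2) <= 2 * Rabs (t - t').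
Proof.
  replace (sin t ^ 2 - sin t' ^ 2) with ((sin t + sin t') * (sin t - sin t')) by ring.
  rewrite Rabs_mult.
  assert (H1 := SIN_bound t). assert (H2 := SIN_bound t').
  assert (Rabs (sin t + sin t') <= 2) by (apply Rabs_le; lra).
  assert (H3 := sin_lipschitz t t'). assert (H4 := Rabs_pos (sin t - sin t')).
  assert (H5 := Rabs_pos (t - t')). nra.
Qed.

Lemma sin_eq_0_IZR t : sin t = 0 <-> exists i : Z, t = IZR i * PI.
Proof.
  split; intros H.
  - now apply sin_eq_0_0.
  - now apply sin_eq_0_1.
Qed.

Lemma pow2_abs_eq x : x ^ 2 = Rabs x ^ 2.
Proof. now rewrite pow2_abs. Qed.

(** The right-hand side of the equation satisfied by the angle [theta] when [V = p sin theta],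
[k V' = p cos theta] and [(k V')' = (l - r g) V]: this is [cos^2 / k + (r g - l) sin^2], written
in terms of the sine only. *)
Definition prufer_field (k g l : R -> R) (r x t : R) : R :=
  / k x + (r * g x - l x - / k x) * sin t ^ 2.

Record coefs (k g l : R -> R) (M : R) : Prop := {
  coef_k : forall x, continuous k x;
  coef_g : forall x, continuous g x;
  coef_l : forall x, continuous l x;
  coef_kpos : forall x, 0 < k x;
  coef_gpos : forall x, 0 < g x;
  coef_lpos : forall x, 0 < l x;
  coef_kb : forall x, / k x <= M;
  coef_gb : forall x, g x <= M;
  coef_lb : forall x, l x <= M }.

Section Prufer.
Variables (k g l : R -> R) (M : R).
Hypothesis HC : coefs k g l M.
Let F := prufer_field k g l.

Lemma coef_kinv_pos x : 0 < / k x.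
Proof. apply Rinv_0_lt_compat, (coef_kpos _ _ _ _ HC). Qed.

Lemma coef_M_pos : 0 < M.
Proof.
  eapply Rlt_le_trans; [apply (coef_gpos _ _ _ _ HC 0)|apply (coef_gb _ _ _ _ HC)].
Qed.

Lemma continuous_kinv x : continuous (fun x => / k x) x.
Proof.
  apply continuous_comp. apply (coef_k _ _ _ _ HC).
  apply continuous_Rinv. apply Rgt_not_eq, (coef_kpos _ _ _ _ HC).
Qed.

Lemma prufer_coef_bound r x : Rabs (r * g x - l x - / k x) <= (Rabs r + 2) * M.
Proof.
  assert (H1 := coef_gb _ _ _ _ HC x). assert (H2 := coef_lb _ _ _ _ HC x).
  assert (H3 := coef_kb _ _ _ _ HC x). assert (H4 := coef_gpos _ _ _ _ HC x).
  assert (H5 := coef_lpos _ _ _ _ HC x). assert (H6 := coef_kinv_pos x).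
  assert (Rabs (r * g x) <= Rabs r * M).
  { rewrite Rabs_mult, (Rabs_pos_eq (g x)) by lra. apply Rmult_le_compat_l; trivial.
    apply Rabs_pos. }
  apply Rabs_le_between in H. apply Rabs_le. lra.
Qed.

Lemma prufer_lipschitz r x t t' :
  Rabs (F r x t - F r x t') <= 2 * (Rabs r + 2) * M * Rabs (t - t').
Proof.
  unfold F, prufer_field.
  replace (_ - _) with ((r * g x - l x - / k x) * (sin t ^ 2 - sin t' ^ 2)) by ring.
  rewrite Rabs_mult. assert (H1 := prufer_coef_bound r x).
  assert (H2 := sin_sq_lipschitz t t').
  replace (2 * (Rabs r + 2) * M * Rabs (t - t')) with
    ((Rabs r + 2) * M * (2 * Rabs (t - t'))) by ring.
  apply Rmult_le_compat; auto using Rabs_pos.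
Qed.

Lemma prufer_angle_exists (r x0 t0 : R) :
  exists theta, theta x0 = t0 /\ forall x, is_derive theta x (F r x (theta x)).
Proof.
  assert (HM := coef_M_pos). assert (Hr := Rabs_pos r).
  apply (scalar_ode_exists (F r) x0 t0 ((Rabs r + 3) * M) (2 * (Rabs r + 2) * M)).
  - nra.
  - intros phi Hphi s. unfold F, prufer_field.
    apply (continuous_plus (fun x => / k x)
             (fun x => (r * g x - l x - / k x) * sin (phi x) ^ 2)).
    apply continuous_kinv.
    apply (continuous_mult (fun x => r * g x - l x - / k x) (fun x => sin (phi x) ^ 2)).
    + apply (continuous_minus (fun x => r * g x - l x) (fun x => / k x)).
      apply (continuous_minus (fun x => r * g x) l).
      apply (continuous_scal_r r g). apply (coef_g _ _ _ _ HC).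
      apply (coef_l _ _ _ _ HC). apply continuous_kinv.
    + apply (continuous_comp phi (fun t => sin t ^ 2)). apply Hphi.
      apply (ex_derive_continuous (fun t => sin t ^ 2)). auto_derive; trivial.
  - intros s t. unfold F, prufer_field. eapply Rle_trans. apply Rabs_triang.
    rewrite Rabs_mult. assert (H1 := prufer_coef_bound r s).
    rewrite (Rabs_pos_eq (/ k s)) by (apply Rlt_le, coef_kinv_pos).
    rewrite (Rabs_pos_eq (sin t ^ 2)) by apply sin_sq_le1.
    assert (H2 := sin_sq_le1 t). assert (H3 := coef_kb _ _ _ _ HC s).
    assert (H4 := Rabs_pos (r * g s - l s - / k s)). nra.
  - intros. apply prufer_lipschitz.
Qed.

Definition prufer_angle (r : R) (theta : R -> R) : Prop :=
  forall x, is_derive theta x (F r x (theta x)).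

(** Given the angle, the polar equations reduce to [p' = (1/k + l - r g) sin theta cos theta p], a
linear equation for the amplitude alone, solved by the exponential of an integral. *)
Lemma prufer_amplitude (r : R) (theta : R -> R) :
  prufer_angle r theta ->
  exists p : R -> R, (forall x, 0 < p x) /\
    (forall x, is_derive (fun x => p x * sin (theta x)) x (p x * cos (theta x) / k x)) /\
    (forall x, is_derive (fun x => p x * cos (theta x)) x
                 ((l x - r * g x) * (p x * sin (theta x)))).
Proof.
  intros Ht.
  assert (Hct : forall x, continuous theta x).
  { intros x. apply (ex_derive_continuous theta). eexists; apply Ht. }
  set (f := fun x => (/ k x + l x - r * g x) * (sin (theta x) * cos (theta x))).
  assert (Hf : forall x, continuous f x).
  { intros x.
    apply (continuous_mult (fun x => / k x + l x - r * g x)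
             (fun x => sin (theta x) * cos (theta x))).
    - apply (continuous_minus (fun x => / k x + l x) (fun x => r * g x)).
      apply (continuous_plus (fun x => / k x) l).
      apply continuous_kinv. apply (coef_l _ _ _ _ HC).
      apply (continuous_scal_r r g). apply (coef_g _ _ _ _ HC).
    - apply (continuous_comp theta (fun t => sin t * cos t)). apply Hct.
      apply (ex_derive_continuous (fun t => sin t * cos t)). auto_derive; trivial. }
  set (p := fun x => exp (RInt f 0 x)).
  assert (Hp : forall x, is_derive p x (p x * f x)).
  { intros x. unfold p. rewrite Rmult_comm.
    apply (is_derive_comp exp (fun x => RInt f 0 x) x). apply is_derive_exp.
    apply (is_derive_RInt f _ 0 x); [|apply Hf].
    apply filter_forall. intros y. apply (RInt_correct (V := R_CompleteNormedModule)).
    apply (ex_RInt_continuous (V := R_CompleteNormedModule)). auto. }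
  exists p. split; [|split]; intros x.
  - apply exp_pos.
  - assert (Hk := coef_kpos _ _ _ _ HC x).
    replace (p x * cos (theta x) / k x) with
      (p x * f x * sin (theta x) + p x * (F r x (theta x) * cos (theta x))).
    + apply (is_derive_mult p (fun x => sin (theta x))); [apply Hp| |intros; apply Rmult_comm].
      apply (is_derive_comp sin theta). apply is_derive_sin. apply Ht.
    + unfold f, F, prufer_field. assert (E := sin2_cos2 (theta x)). unfold Rsqr in E.
      set (s := sin (theta x)) in *. set (c := cos (theta x)) in *.
      unfold Rdiv. ring_simplify.
      replace (p x * c * / k x) with (p x * c * / k x + 0) by ring. ring.
  - replace ((l x - r * g x) * (p x * sin (theta x))) with
      (p x * f x * cos (theta x) + p x * (F r x (theta x) * (- sin (theta x)))).
    + apply (is_derive_mult p (fun x => cos (theta x))); [apply Hp| |intros; apply Rmult_comm].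
      apply (is_derive_comp cos theta). apply is_derive_cos. apply Ht.
    + unfold f, F, prufer_field. assert (E := sin2_cos2 (theta x)). unfold Rsqr in E.
      set (s := sin (theta x)) in *. set (c := cos (theta x)) in *.
      assert (E' : c * c = 1 - s * s) by lra.
      replace (p x * ((/ k x + l x - r * g x) * (s * c)) * c) with
        (p x * ((/ k x + l x - r * g x) * s) * (c * c)) by ring.
      rewrite E'. ring.
Qed.

Lemma prufer_crossing r theta (c x y : R) :
  prufer_angle r theta -> x < y -> c <= theta x ->
  (forall z, x <= z <= y -> 0 < F r z c) -> c < theta y.
Proof.
  intros Ht Hxy Hc HF.
  apply (crossing_up theta (fun x => F r x (theta x)) c x y); auto.
  intros z Hz E. rewrite E. auto.
Qed.

(** Where the sine vanishes the field equals [1 / k > 0]: zeros of the solution are passed with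
increasing angle. *)
Lemma prufer_crossing_multiple r theta (i : Z) (x y : R) :
  prufer_angle r theta -> x < y -> IZR i * PI <= theta x -> IZR i * PI < theta y.
Proof.
  intros Ht Hxy Hc. apply (prufer_crossing r theta _ x y); auto.
  intros z _. unfold F, prufer_field.
  assert (E : sin (IZR i * PI) = 0) by (apply sin_eq_0_IZR; eauto).
  rewrite E. assert (H := coef_kinv_pos z). lra.
Qed.

(** For [r = 0] the field at [PI / 2] is [- l < 0], so the angle cannot climb above [PI / 2]. This
starts the search for eigenvalues at [r = 0]. *)
Lemma prufer_angle_le_PI2 theta x y :
  prufer_angle 0 theta -> x < y -> theta x <= PI / 2 -> theta y <= PI / 2.
Proof.
  intros Ht Hxy Hx.
  assert (- (PI / 2) < - theta y); [|lra].
  apply (crossing_up (fun x => - theta x) (fun x => - F 0 x (theta x)) _ x y); auto; [lra| |].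
  - intros z _. apply (is_derive_opp theta). apply Ht.
  - intros z _ E. replace (theta z) with (PI / 2) by lra.
    unfold F, prufer_field. rewrite sin_PI2. assert (H := coef_lpos _ _ _ _ HC z). lra.
Qed.

(** Gronwall's inequality applied to [(theta - theta')^2 + (r - r')^2]; adding the constant turns the
inhomogeneous linear estimate on the difference of the angles into a homogeneous one. *)
Lemma prufer_param_close r r' theta theta' x y :
  prufer_angle r theta -> prufer_angle r' theta' -> x <= y -> theta x = theta' x ->
  (theta y - theta' y) ^ 2 <=
    (r - r') ^ 2 * exp ((4 * (Rabs r + 2) * M + M) * (y - x)).
Proof.
  intros Ht Ht' Hxy E0.
  assert (HM := coef_M_pos). assert (Hr := Rabs_pos r).
  set (d := fun x => theta x - theta' x).
  set (dd := fun x => F r x (theta x) - F r' x (theta' x)).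
  assert (Hd : forall x, is_derive d x (dd x)).
  { intros z. apply (is_derive_minus theta theta'). apply Ht. apply Ht'. }
  assert (H2 : forall x, is_derive (fun x => d x ^ 2 + (r - r') ^ 2) x (2 * d x * dd x)).
  { intros z. replace (2 * d z * dd z) with ((INR 2 * dd z * d z ^ 1) + 0) by (simpl; ring).
    apply (is_derive_plus (fun x => d x ^ 2) (fun _ => (r - r') ^ 2)).
    apply (is_derive_pow d 2). apply Hd.
    apply (@is_derive_const R_AbsRing R_NormedModule). }
  assert (G := gronwall (fun x => d x ^ 2 + (r - r') ^ 2) (fun x => 2 * d x * dd x)
    (4 * (Rabs r + 2) * M + M) x y Hxy).
  cbv beta in G.
  assert (Ex : d x = 0) by (unfold d; lra).
  rewrite Ex in G. fold (d y).
  assert (d y ^ 2 + (r - r') ^ 2 <= (0 ^ 2 + (r - r') ^ 2) *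
     exp ((4 * (Rabs r + 2) * M + M) * (y - x))).
  { apply G.
    - intros z _. eapply is_derive_continuity_pt, H2.
    - auto.
    - intros z _.
      assert (Hdd : Rabs (dd z) <= 2 * (Rabs r + 2) * M * Rabs (d z) + Rabs (r - r') * M).
      { unfold dd.
        replace (F r z (theta z) - F r' z (theta' z)) with
          ((F r z (theta z) - F r z (theta' z)) + (r - r') * (g z * sin (theta' z) ^ 2)).
        2:{ unfold F, prufer_field. ring. }
        eapply Rle_trans. apply Rabs_triang.
        apply Rplus_le_compat. apply prufer_lipschitz.
        rewrite Rabs_mult. apply Rmult_le_compat_l. apply Rabs_pos.
        assert (S := sin_sq_le1 (theta' z)).
        assert (g1 := coef_gpos _ _ _ _ HC z). assert (g2 := coef_gb _ _ _ _ HC z).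
        rewrite Rabs_pos_eq; nra. }
      assert (A1 := Rabs_pos (d z)). assert (A2 := Rabs_pos (r - r')).
      rewrite (pow2_abs_eq (d z)), (pow2_abs_eq (r - r')).
      eapply Rle_trans. apply (Rle_abs (2 * d z * dd z)).
      rewrite !Rabs_mult, (Rabs_pos_eq 2) by lra.
      set (a := Rabs (d z)) in *. set (b := Rabs (r - r')) in *.
      assert (2 * a * Rabs (dd z) <= 2 * a * (2 * (Rabs r + 2) * M * a + b * M)) by
        (apply Rmult_le_compat_l; lra).
      assert (M * (2 * (a * b)) <= M * (a ^ 2 + b ^ 2)).
      { apply Rmult_le_compat_l; [lra|]. assert (Hab := pow2_ge_0 (a - b)). nra. }
      assert (0 <= 4 * (Rabs r + 2) * M * b ^ 2).
      { apply Rmult_le_pos; [apply Rmult_le_pos; lra|apply pow2_ge_0]. }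
      nra. }
  assert (Hsq := pow2_ge_0 (r - r')). lra.
Qed.

(** The difference [d] of the angles satisfies [d' >= - C * |d| + (r' - r) g sin^2 theta'], so it stays
nonnegative and [d * exp (C x)] is nondecreasing. If it vanished at [y] it would vanish throughout,
forcing [sin theta' = 0] on an interval, where however [theta' ] has derivative [1 / k]. *)
Lemma prufer_strict_mono r r' theta theta' x y :
  prufer_angle r theta -> prufer_angle r' theta' -> x < y -> theta x = theta' x ->
  r < r' -> theta y < theta' y.
Proof.
  intros Ht Ht' Hxy E0 Hr.
  assert (HM := coef_M_pos). assert (Hr0 := Rabs_pos r).
  set (C := 2 * (Rabs r + 2) * M).
  assert (HC0 : 0 < C) by (unfold C; nra).
  set (d := fun x => theta' x - theta x).
  set (dd := fun x => F r' x (theta' x) - F r x (theta x)).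
  assert (Hd : forall x, is_derive d x (dd x)).
  { intros z. apply (is_derive_minus theta' theta). apply Ht'. apply Ht. }
  assert (Hdd : forall z, - C * Rabs (d z) + (r' - r) * (g z * sin (theta' z) ^ 2) <= dd z).
  { intros z. assert (H := prufer_lipschitz r z (theta' z) (theta z)).
    fold (d z) in H. fold C in H. apply Rabs_le_between in H.
    unfold dd. replace (F r' z (theta' z)) with
      (F r z (theta' z) + (r' - r) * (g z * sin (theta' z) ^ 2)).
    2:{ unfold F, prufer_field. ring. }
    lra. }
  assert (Hpos : forall z, 0 <= (r' - r) * (g z * sin (theta' z) ^ 2)).
  { intros z. assert (g1 := coef_gpos _ _ _ _ HC z). assert (S := sin_sq_le1 (theta' z)).
    apply Rmult_le_pos; [lra|]. nra. }
  (* adding a small growing exponential makes the zero level crossed strictly upwards *)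
  assert (Hge : forall z, x <= z -> 0 <= d z).
  { intros z Hz. destruct (Req_dec x z) as [<-|N]. unfold d; lra.
    destruct (Rle_lt_dec 0 (d z)) as [|Neg]; trivial. exfalso.
    set (w := fun y => exp ((C + 1) * y)).
    assert (Hw : forall y, is_derive w y ((C + 1) * w y)).
    { intros t. unfold w. auto_derive; trivial. ring. }
    assert (Hw0 : forall y, 0 < w y) by (intros; apply exp_pos).
    set (e := - d z / w z).
    assert (He : 0 < e) by (apply Rdiv_lt_0_compat; [lra|apply Hw0]).
    assert (X : 0 < d z + e * w z).
    { apply (crossing_up (fun y => d y + e * w y) (fun y => dd y + e * ((C + 1) * w y)) 0 x z).
      - lra.
      - assert (d x = 0) by (unfold d; lra). specialize (Hw0 x). nra.
      - intros t _. apply (is_derive_plus d (fun y => e * w y)). apply Hd.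
        apply (is_derive_scal w). apply Hw.
      - intros t _ E. specialize (Hdd t). specialize (Hpos t). specialize (Hw0 t).
        assert (0 < e * w t) by nra.
        rewrite (Rabs_left (d t)) in Hdd by lra. nra. }
    assert (e * w z = - d z). { unfold e. field. apply Rgt_not_eq, Hw0. }
    lra. }
  assert (Hmono : forall z t, x <= z <= t -> d z * exp (C * z) <= d t * exp (C * t)).
  { intros z t Hzt.
    assert (Hw : forall y, is_derive (fun y => exp (C * y)) y (C * exp (C * y))).
    { intros s. auto_derive; trivial. ring. }
    assert (Hde : forall y, is_derive (fun y => d y * exp (C * y)) y
                 (dd y * exp (C * y) + d y * (C * exp (C * y)))).
    { intros s. apply (is_derive_mult d (fun y => exp (C * y))); auto. intros; apply Rmult_comm. }
    apply (nondecreasing_of_derive_ge0 (fun y => d y * exp (C * y))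
      (fun y => dd y * exp (C * y) + d y * (C * exp (C * y))) z t (proj2 Hzt)).
    - intros s _. eapply is_derive_continuity_pt, Hde.
    - intros s _. apply Hde.
    - intros s Hs. specialize (Hdd s). specialize (Hge s ltac:(lra)).
      rewrite Rabs_pos_eq in Hdd by lra. specialize (Hpos s).
      assert (He := exp_pos (C * s)). nra. }
  assert (Hzero : d y = 0 -> forall z, x <= z <= y -> d z = 0).
  { intros Ey z Hz. assert (H := Hmono z y Hz). rewrite Ey in H.
    assert (He := exp_pos (C * z)). specialize (Hge z (proj1 Hz)). nra. }
  assert (Hy := Hge y (Rlt_le _ _ Hxy)).
  destruct (Rle_lt_or_eq_dec _ _ Hy) as [G|G]; [unfold d in G; lra|exfalso].
  specialize (Hzero (eq_sym G)).
  assert (Hsin : forall z, x < z < y -> sin (theta' z) = 0).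
  { intros z Hz. destruct (Req_dec (sin (theta' z)) 0) as [|N]; trivial. exfalso.
    assert (0 < dd z).
    { specialize (Hdd z). rewrite (Hzero z) in Hdd by lra. rewrite Rabs_R0 in Hdd.
      assert (g1 := coef_gpos _ _ _ _ HC z).
      assert (0 < sin (theta' z) ^ 2) by (apply pow2_gt_0; trivial).
      assert (0 < (r' - r) * (g z * sin (theta' z) ^ 2)).
      { apply Rmult_lt_0_compat; [lra|]. now apply Rmult_lt_0_compat. }
      lra. }
    destruct (is_derive_pos_local d z (dd z) (Hd z) H) as [e [He Hee]].
    set (t := z + Rmin (e / 2) ((y - z) / 2)).
    assert (Rmin (e / 2) ((y - z) / 2) <= e / 2) by apply Rmin_l.
    assert (Rmin (e / 2) ((y - z) / 2) <= (y - z) / 2) by apply Rmin_r.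
    assert (0 < Rmin (e / 2) ((y - z) / 2)) by (apply Rmin_glb_lt; lra).
    specialize (Hee t ltac:(unfold t; lra) ltac:(apply Rabs_def1; unfold t; lra)).
    rewrite (Hzero z), (Hzero t) in Hee by (unfold t; lra). lra. }
  set (z := (x + y) / 2).
  assert (D1 : is_derive (fun y => sin (theta' y)) z (F r' z (theta' z) * cos (theta' z))).
  { apply (is_derive_comp sin theta'). apply is_derive_sin. apply Ht'. }
  assert (D2 : is_derive (fun y => sin (theta' y)) z 0).
  { apply is_derive_ext_loc with (fun _ => 0).
    - assert (Hd0 : 0 < (y - x) / 2) by lra. exists (mkposreal _ Hd0). intros t Htt.
      symmetry. apply Hsin. apply Rabs_def2 in Htt. simpl in Htt.
      unfold minus, plus, opp in Htt; simpl in Htt. unfold z in Htt. lra.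
    - apply (@is_derive_const R_AbsRing R_NormedModule). }
  apply is_derive_unique in D1. apply is_derive_unique in D2. rewrite D1 in D2.
  assert (Sz : sin (theta' z) = 0) by (apply Hsin; unfold z; lra).
  assert (E := sin2_cos2 (theta' z)). unfold Rsqr in E. rewrite Sz in E.
  unfold F, prufer_field in D2. rewrite Sz in D2.
  assert (Hk := coef_kinv_pos z).
  apply Rmult_integral in D2. destruct D2 as [D2|D2]; [lra|]. rewrite D2 in E. lra.
Qed.

End Prufer.

(** * Boundary conditions, one-sided derivatives and uniqueness *)

Lemma sin_atan_eq a : sin (atan a) = a * cos (atan a).
Proof.
  assert (H := atan_bound a). assert (Hc : 0 < cos (atan a)) by (apply cos_gt_0; lra).
  rewrite <- (tan_atan a) at 2. unfold tan. field. lra.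
Qed.

(** In polar form, Robin and Dirichlet conditions alike fix the angle modulo [PI]; [h >= 0] puts it in
the first quadrant. *)
Lemma left_condition_angle (h : Rbar) : Rbar_le 0 h ->
  exists t0, 0 <= t0 <= PI / 2 /\
    forall k v dv, left_condition h k v dv <-> v * cos t0 = k * dv * sin t0.
Proof.
  assert (HPI := PI_RGT_0).
  destruct h as [h| |]; intros Hh; simpl in Hh; try easy.
  - exists (PI / 2 - atan h).
    assert (Ha := atan_bound h).
    assert (Hc : 0 < cos (atan h)) by (apply cos_gt_0; lra).
    assert (Ha' : 0 <= atan h).
    { rewrite <- atan_0. destruct Hh as [Hh| <-]; [|lra]. apply Rlt_le, atan_increasing; trivial. }
    split; [lra|]. intros k v dv. simpl.
    rewrite cos_shift, sin_shift, sin_atan_eq.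
    split; intros E.
    + replace (k * dv) with (h * v) by lra. ring.
    + apply Rmult_eq_reg_r with (cos (atan h)); lra.
  - exists 0. split; [lra|]. intros k v dv. simpl. rewrite sin_0, cos_0. split; lra.
Qed.

(** The sign of the condition is opposite to that at the left endpoint, which puts the angle in the
second quadrant. *)
Lemma right_condition_angle (h : Rbar) : Rbar_le 0 h ->
  exists gam, PI / 2 <= gam <= PI /\
    forall k v dv, right_condition h k v dv <-> v * cos gam = k * dv * sin gam.
Proof.
  assert (HPI := PI_RGT_0).
  destruct h as [h| |]; intros Hh; simpl in Hh; try easy.
  - exists (PI / 2 + atan h).
    assert (Ha := atan_bound h).
    assert (Hc : 0 < cos (atan h)) by (apply cos_gt_0; lra).
    assert (Ha' : 0 <= atan h).
    { rewrite <- atan_0. destruct Hh as [Hh| <-]; [|lra]. apply Rlt_le, atan_increasing; trivial. }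
    split; [lra|]. intros k v dv. simpl.
    rewrite cos_plus, sin_plus, cos_PI2, sin_PI2, sin_atan_eq.
    split; intros E.
    + replace (k * dv) with (- h * v) by lra. ring.
    + apply Rmult_eq_reg_r with (cos (atan h)); lra.
  - exists PI. split; [lra|]. intros k v dv. simpl. rewrite sin_PI, cos_PI. split; lra.
Qed.

Definition clamp (a b x : R) : R := Rmax a (Rmin b x).

Lemma clamp_in a b x : a <= b -> a <= clamp a b x <= b.
Proof.
  intros H. unfold clamp. split; [apply Rmax_l|apply Rmax_lub; [lra|apply Rmin_l]].
Qed.

Lemma clamp_id a b x : a <= x <= b -> clamp a b x = x.
Proof. intros H. unfold clamp. rewrite Rmin_right, Rmax_right; lra. Qed.

Lemma clamp_lipschitz a b x y : Rabs (clamp a b x - clamp a b y) <= Rabs (x - y).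
Proof.
  unfold clamp, Rmax, Rmin.
  repeat (destruct (Rle_dec _ _)); unfold Rabs; repeat destruct (Rcase_abs _); lra.
Qed.

Lemma continuity_clamp (f : R -> R) a b x : a <= b ->
  (forall e, 0 < e -> exists d, 0 < d /\ forall y, a <= y <= b -> Rabs (y - clamp a b x) < d ->
     Rabs (f y - f (clamp a b x)) < e) ->
  continuity_pt (fun x => f (clamp a b x)) x.
Proof.
  intros Hab H e He. destruct (H e He) as [d [Hd Hdd]]. exists d. split; trivial.
  intros y [_ Hy]. apply Hdd. now apply clamp_in.
  eapply Rle_lt_trans; [apply clamp_lipschitz|exact Hy].
Qed.

Lemma is_derive_in_eps a b f x l : is_derive_in a b f x l <->
  forall e, 0 < e -> exists d, 0 < d /\ forall y, a <= y <= b -> y <> x ->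
    Rabs (y - x) < d -> Rabs ((f y - f x) / (y - x) - l) < e.
Proof.
  split.
  - intros H e He.
    destruct (H (fun z => Rabs (z - l) < e)) as [d Hd].
    { exists (mkposreal e He). intros y Hy. exact Hy. }
    exists d. split; [apply cond_pos|]. intros y Hy Hyx Hyd. now apply (Hd y).
  - intros H P [e He]. destruct (H e (cond_pos e)) as [d [Hd Hdd]].
    exists (mkposreal d Hd). intros y Hy Hyx Hyab. apply He. apply Hdd; trivial.
Qed.

(** Composing with [clamp] turns one-sided continuity at the endpoints into ordinary continuity. *)
Lemma is_derive_in_continuity a b f x l : a <= x <= b ->
  is_derive_in a b f x l -> continuity_pt (fun x => f (clamp a b x)) x.
Proof.
  intros Hx H. rewrite is_derive_in_eps in H.
  apply continuity_clamp; [lra|]. rewrite clamp_id by trivial. intros e He.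
  destruct (H 1 Rlt_0_1) as [d [Hd Hdd]].
  assert (Hl := Rabs_pos l).
  exists (Rmin d (e / (Rabs l + 1))).
  assert (He' : 0 < e / (Rabs l + 1)) by (apply Rdiv_lt_0_compat; lra).
  split; [now apply Rmin_pos|]. intros y Hy Hyd.
  destruct (Req_dec y x) as [->|N]. rewrite Rminus_diag, Rabs_R0; trivial.
  specialize (Hdd y Hy N (Rlt_le_trans _ _ _ Hyd (Rmin_l _ _))).
  assert (Hye := Rlt_le_trans _ _ _ Hyd (Rmin_r _ _)).
  replace (f y - f x) with ((f y - f x) / (y - x) * (y - x)) by (field; lra).
  rewrite Rabs_mult. set (Q := (f y - f x) / (y - x)) in *.
  assert (Rabs Q <= Rabs l + 1).
  { replace Q with ((Q - l) + l) by ring. eapply Rle_trans; [apply Rabs_triang|lra]. }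
  replace e with ((Rabs l + 1) * (e / (Rabs l + 1))) by (field; lra).
  assert (H1 := Rabs_pos (y - x)). assert (H2 := Rabs_pos Q).
  apply Rle_lt_trans with ((Rabs l + 1) * Rabs (y - x)).
  apply Rmult_le_compat_r; lra. apply Rmult_lt_compat_l; lra.
Qed.

Lemma is_derive_in_interior a b f x l : a < x < b ->
  is_derive_in a b f x l -> is_derive (fun x => f (clamp a b x)) x l.
Proof.
  intros Hx H. rewrite is_derive_in_eps in H. apply is_derive_Reals.
  intros e He. destruct (H e He) as [d [Hd Hdd]].
  assert (Hm : 0 < Rmin d (Rmin (x - a) (b - x))) by (repeat apply Rmin_pos; lra).
  exists (mkposreal _ Hm). intros t Ht Htd. simpl in Htd.
  assert (H1 := Rlt_le_trans _ _ _ Htd (Rmin_l _ _)).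
  assert (H2 := Rlt_le_trans _ _ _ Htd (Rmin_r _ _)).
  assert (H3 := Rlt_le_trans _ _ _ H2 (Rmin_l _ _)).
  assert (H4 := Rlt_le_trans _ _ _ H2 (Rmin_r _ _)).
  apply Rabs_def2 in H3. apply Rabs_def2 in H4.
  rewrite !clamp_id by lra.
  specialize (Hdd (x + t) ltac:(lra) ltac:(lra)).
  replace (x + t - x) with t in Hdd by ring. auto.
Qed.

Lemma is_derive_in_of_derive a b f g x l : a <= x <= b ->
  (forall y, a <= y <= b -> f y = g y) -> is_derive g x l -> is_derive_in a b f x l.
Proof.
  intros Hx Hfg H. apply is_derive_in_eps. intros e He.
  apply is_derive_Reals in H. destruct (H e He) as [d Hd].
  exists d. split; [apply cond_pos|]. intros y Hy N Hyd.
  specialize (Hd (y - x) ltac:(lra) Hyd). replace (x + (y - x)) with y in Hd by ring.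
  now rewrite !Hfg.
Qed.

Section Uniqueness.
Variables (k g l : R -> R) (M : R).
Hypothesis HC : coefs k g l M.
Variables (al be r c : R) (V Q u q : R -> R).
Hypothesis Hab : al < be.
Hypothesis HV : forall x, al <= x <= be -> is_derive_in al be V x (Q x / k x).
Hypothesis HQ : forall x, al <= x <= be -> is_derive_in al be Q x ((l x - r * g x) * V x).
Hypothesis Hu : forall x, is_derive u x (q x / k x).
Hypothesis Hq : forall x, is_derive q x ((l x - r * g x) * u x).
Hypothesis H0 : V al = c * u al.
Hypothesis H1 : Q al = c * q al.

(** The sum of the squares of [V - c u] and [Q - c q] vanishes at [al] and grows at most exponentially
at a bounded rate, hence it vanishes on the whole interval. *)
Lemma cauchy_problem_unique x : al <= x <= be -> V x = c * u x /\ Q x = c * q x.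
Proof.
  intros Hx.
  set (a := fun x => V (clamp al be x) - c * u x).
  set (b := fun x => Q (clamp al be x) - c * q x).
  assert (Ha : forall y, al < y < be -> is_derive a y (b y / k y)).
  { intros y Hy. replace (b y / k y) with (Q y / k y - c * (q y / k y)).
    2:{ unfold b. rewrite clamp_id by lra. unfold Rdiv. ring. }
    apply (is_derive_minus (fun x => V (clamp al be x)) (fun x => c * u x)).
    apply is_derive_in_interior; trivial. apply HV; lra.
    apply (is_derive_scal u). apply Hu. }
  assert (Hb : forall y, al < y < be -> is_derive b y ((l y - r * g y) * a y)).
  { intros y Hy. replace ((l y - r * g y) * a y) with
      ((l y - r * g y) * V y - c * ((l y - r * g y) * u y)).
    2:{ unfold a. rewrite clamp_id by lra. ring. }
    apply (is_derive_minus (fun x => Q (clamp al be x)) (fun x => c * q x)).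
    apply is_derive_in_interior; trivial. apply HQ; lra.
    apply (is_derive_scal q). apply Hq. }
  assert (Hca : forall y, al <= y <= be -> continuity_pt a y).
  { intros y Hy. apply continuity_pt_minus.
    eapply is_derive_in_continuity, HV; trivial.
    apply continuity_pt_scal. eapply is_derive_continuity_pt, Hu. }
  assert (Hcb : forall y, al <= y <= be -> continuity_pt b y).
  { intros y Hy. apply continuity_pt_minus.
    eapply is_derive_in_continuity, HQ; trivial.
    apply continuity_pt_scal. eapply is_derive_continuity_pt, Hq. }
  assert (Ea : a al = 0) by (unfold a; rewrite clamp_id; lra).
  assert (Eb : b al = 0) by (unfold b; rewrite clamp_id; lra).
  assert (G := gronwall (fun y => a y * a y + b y * b y)
    (fun y => (b y / k y * a y + a y * (b y / k y)) +
       ((l y - r * g y) * a y * b y + b y * ((l y - r * g y) * a y)))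
    ((Rabs r + 2) * M) al x (proj1 Hx)). cbv beta in G.
  rewrite Ea, Eb in G.
  assert (G' : a x * a x + b x * b x <= (0 * 0 + 0 * 0) * exp ((Rabs r + 2) * M * (x - al))).
  { apply G.
    - intros y Hy. assert (al <= y <= be) by lra.
      apply (continuity_pt_plus (fun y => a y * a y) (fun y => b y * b y));
      apply continuity_pt_mult; auto.
    - intros y Hy. assert (al < y < be) by lra.
      apply (is_derive_plus (fun y => a y * a y) (fun y => b y * b y)).
      apply (is_derive_mult a a); auto. intros; apply Rmult_comm.
      apply (is_derive_mult b b); auto. intros; apply Rmult_comm.
    - intros y _. 
          assert (Hk := coef_kinv_pos k g l M HC y). assert (HkM := coef_kb _ _ _ _ HC y).
      assert (HgM := coef_gb _ _ _ _ HC y). assert (HlM := coef_lb _ _ _ _ HC y).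
      assert (Hg := coef_gpos _ _ _ _ HC y). assert (Hl := coef_lpos _ _ _ _ HC y).
      assert (Hrg : Rabs (r * g y) <= Rabs r * M).
      { rewrite Rabs_mult, (Rabs_pos_eq (g y)) by lra. apply Rmult_le_compat_l; trivial.
        apply Rabs_pos. }
      apply Rabs_le_between in Hrg.
      set (s := / k y + l y - r * g y).
      assert (Hs : - ((Rabs r + 2) * M) <= s <= (Rabs r + 2) * M) by (unfold s; lra).
      replace (_ + _) with (s * (2 * (a y * b y))) by (unfold s, Rdiv; ring).
      set (C := (Rabs r + 2) * M) in *. set (A := a y). set (B := b y).
      assert (U1 : 0 <= (C - s) * ((A + B) * (A + B))) by (apply Rmult_le_pos; [lra|apply Rle_0_sqr]).
      assert (U2 : 0 <= (C + s) * ((A - B) * (A - B))) by (apply Rmult_le_pos; [lra|apply Rle_0_sqr]).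
      nra. }
  assert (a x = 0 /\ b x = 0) as [Za Zb] by (split; nra).
  unfold a, b in Za, Zb. rewrite clamp_id in Za, Zb by trivial. lra.
Qed.
End Uniqueness.

(** Below an eigenvalue with value [gam + i * PI], the intermediate value theorem produces an
eigenvalue for each smaller index [i']. Hence going from one eigenvalue to the next raises the
index by exactly one, starting from [0]. *)
Lemma eigenvalue_index (T : R -> R) (rho : nat -> R) (gam : R) :
  continuity T -> (forall r r', r < r' -> T r < T r') -> T 0 <= gam ->
  (forall j, (1 <= j)%nat -> rho j < rho (S j)) ->
  (forall r, (exists i : nat, T r = gam + INR i * PI) <-> exists j, (1 <= j)%nat /\ r = rho j) ->
  forall j, T (rho (S j)) = gam + INR j * PI.
Proof.
  intros Hc Hm H0 Hrho Heig.
  assert (HPI := PI_RGT_0).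
  assert (Hinv : forall r r', T r < T r' -> r < r').
  { intros r r' H. destruct (Rlt_le_dec r r') as [|[G| ->]]; trivial.
    specialize (Hm _ _ G). lra. lra. }
  assert (Hrho' : forall i j, (1 <= i)%nat -> (i <= j)%nat -> rho i <= rho j).
  { intros i j Hi Hij. induction Hij. lra. specialize (Hrho m ltac:(lia)). lra. }
  assert (Hivt : forall r (i' i : nat), T r = gam + INR i * PI -> (i' < i)%nat ->
     exists j, (1 <= j)%nat /\ rho j < r /\ T (rho j) = gam + INR i' * PI).
  { intros r i' i Hr Hi. assert (Hi1 := lt_INR _ _ Hi).
    assert (Hi0 := pos_INR i').
    destruct (IVT_gen T 0 r (gam + INR i' * PI) Hc) as [s [_ Hs]].
    { assert (gam + INR i' * PI <= T r) by nra.
      assert (T 0 <= gam + INR i' * PI) by nra.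
      rewrite Rmin_left, Rmax_right by lra. lra. }
    destruct (proj1 (Heig s)) as [j [Hj ->]]; [eauto|].
    exists j. repeat split; trivial. apply Hinv. rewrite Hs, Hr.
    assert (INR i' * PI < INR i * PI) by (apply Rmult_lt_compat_r; lra). lra. }
  induction j as [|j IH].
  - destruct (proj2 (Heig (rho 1%nat))) as [i Hi]; [exists 1%nat; auto|].
    destruct i as [|i]; trivial. exfalso.
    destruct (Hivt _ 0%nat _ Hi) as [j [Hj [Hj1 _]]]; [lia|].
    specialize (Hrho' 1%nat j ltac:(lia) Hj). lra.
  - destruct (proj2 (Heig (rho (S (S j))))) as [i Hi]; [exists (S (S j)); split; auto; lia|].
    assert (Hlt := Hm _ _ (Hrho (S j) ltac:(lia))). rewrite IH, Hi in Hlt.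
    assert (INR j < INR i) by nra. apply INR_lt in H.
    destruct (Nat.eq_dec i (S j)) as [->|N]; trivial. exfalso.
    destruct (Hivt _ (S j) _ Hi) as [j' [Hj' [Hlt' Ej']]]; [lia|].
    assert (Hj1 : rho (S j) < rho j').
    { apply Hinv. rewrite IH, Ej'. rewrite S_INR. nra. }
    destruct (le_lt_dec j' (S j)) as [L|L].
    + specialize (Hrho' _ _ Hj' L). lra.
    + specialize (Hrho' (S (S j)) j' ltac:(lia) ltac:(lia)). lra.
Qed.

(** * Eigenvalues and Prufer angles *)

(** Extending the coefficients by constants keeps them continuous, positive and bounded, which is all
that existence on the whole line requires; higher derivatives matter in the open interval only. *)
Lemma coefs_clamp (alpha0 beta0 : Rbar) (al be : R) (K G L : R -> R) :
  al < be -> in_open alpha0 beta0 al -> in_open alpha0 beta0 be ->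
  smooth_on alpha0 beta0 K -> smooth_on alpha0 beta0 G -> smooth_on alpha0 beta0 L ->
  (forall x, in_open alpha0 beta0 x -> 0 < K x) ->
  (forall x, in_open alpha0 beta0 x -> 0 < G x) ->
  (forall x, in_open alpha0 beta0 x -> 0 < L x) ->
  exists M, coefs (fun x => K (clamp al be x)) (fun x => G (clamp al be x))
                  (fun x => L (clamp al be x)) M.
Proof.
  intros Hab Ha Hb HK HG HL HKp HGp HLp.
  assert (Hin : forall x, al <= x <= be -> in_open alpha0 beta0 x).
  { intros x Hx. split.
    - apply Rbar_lt_le_trans with al. apply Ha. simpl; lra.
    - apply Rbar_le_lt_trans with be. simpl; lra. apply Hb. }
  assert (Hcp : forall f, smooth_on alpha0 beta0 f -> forall x, al <= x <= be -> continuity_pt f x).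
  { intros f Hf x Hx. destruct (Hf 1%nat x (Hin x Hx)) as [d Hd].
    eapply is_derive_continuity_pt, Hd. }
  assert (Hcl : forall f, smooth_on alpha0 beta0 f ->
            forall x, continuous (fun x => f (clamp al be x)) x).
  { intros f Hf x. apply continuity_pt_filterlim. apply continuity_clamp; [lra|].
    intros e He.
    destruct (continuity_pt_eps f (clamp al be x) e) as [d [Hd Hdd]]; trivial.
    - apply Hcp; trivial. apply clamp_in; lra.
    - exists d. split; auto. }
  assert (Hmax : forall f, (forall x, al <= x <= be -> continuity_pt f x) ->
            exists m, forall x, f (clamp al be x) <= m).
  { intros f Hf. destruct (continuity_ab_maj f al be) as [z [Hz _]]; [lra|trivial|].
    exists (f z). intros x. apply Hz, clamp_in. lra. }
  destruct (Hmax (fun x => / K x)) as [m1 H1].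
  { intros x Hx. apply continuity_pt_inv; auto. apply Rgt_not_eq, HKp, Hin, Hx. }
  destruct (Hmax G) as [m2 H2]; auto. destruct (Hmax L) as [m3 H3]; auto.
  assert (Hcin : forall x, in_open alpha0 beta0 (clamp al be x)).
  { intros x. apply Hin, clamp_in. lra. }
  exists (Rmax m1 (Rmax m2 m3)). split; auto.
  - intros x. eapply Rle_trans; [apply H1|apply Rmax_l].
  - intros x. eapply Rle_trans; [apply H2|]. eapply Rle_trans; [|apply Rmax_r]. apply Rmax_l.
  - intros x. eapply Rle_trans; [apply H3|]. eapply Rle_trans; [|apply Rmax_r]. apply Rmax_r.
Qed.

Section Spectrum.
Variables (al be : R) (K G L k g l : R -> R) (M : R) (h H : Rbar) (t0 gam : R).
Hypothesis Hab : al < be.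
Hypothesis HC : coefs k g l M.
Hypothesis Hk : forall x, al <= x <= be -> k x = K x.
Hypothesis Hg : forall x, al <= x <= be -> g x = G x.
Hypothesis Hl : forall x, al <= x <= be -> l x = L x.
Hypothesis Ht0 : 0 <= t0 <= PI / 2.
Hypothesis Hh : forall k v dv, left_condition h k v dv <-> v * cos t0 = k * dv * sin t0.
Hypothesis Hgam : PI / 2 <= gam <= PI.
Hypothesis HH : forall k v dv, right_condition H k v dv <-> v * cos gam = k * dv * sin gam.

(** The left condition makes the Cauchy data of [V] at [al] a multiple of those of the polar solution,
so [V] is that multiple of it; the right condition then bears on the angle alone. *)
Lemma eigenfunction_multiple r V theta p :
  is_eigenfunction al be K G L h H r V ->
  prufer_angle k g l r theta -> theta al = t0 ->
  (forall x, 0 < p x) ->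
  (forall x, is_derive (fun x => p x * sin (theta x)) x (p x * cos (theta x) / k x)) ->
  (forall x, is_derive (fun x => p x * cos (theta x)) x
                 ((l x - r * g x) * (p x * sin (theta x)))) ->
  sin (theta be - gam) = 0 /\
  exists c, c <> 0 /\ forall x, al <= x <= be -> V x = c * (p x * sin (theta x)).
Proof.
  intros [[x0 [Hx0 HVx0]] [dV [HdV [HQ [HL0 HR0]]]]] Ht Hal Hp Hu Hq.
  apply Hh in HL0. apply HH in HR0.
  assert (E := sin2_cos2 t0). unfold Rsqr in E.
  set (Q := fun x => K x * dV x). fold (Q al) in HL0. fold (Q be) in HR0.
  set (c := (V al * sin t0 + Q al * cos t0) / p al).
  assert (Hpa := Hp al).
  assert (U : forall x, al <= x <= be ->
     V x = c * (p x * sin (theta x)) /\ Q x = c * (p x * cos (theta x))).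
  { apply (cauchy_problem_unique k g l M HC al be r c V Q (fun x => p x * sin (theta x))
             (fun x => p x * cos (theta x))); trivial.
    - intros x Hx. replace (Q x / k x) with (dV x). auto.
      unfold Q. rewrite <- Hk by trivial. field. apply Rgt_not_eq, (coef_kpos _ _ _ _ HC).
    - intros x Hx. destruct (HQ x Hx) as [d [Hd Ed]].
      replace ((l x - r * g x) * V x) with d; trivial.
      rewrite Hg, Hl by trivial. lra.
    - rewrite Hal. unfold c.
      replace ((V al * sin t0 + Q al * cos t0) / p al * (p al * sin t0)) with
        (V al * (sin t0 * sin t0) + sin t0 * cos t0 * Q al) by (field; lra).
      replace (sin t0 * cos t0 * Q al) with (V al * (cos t0 * cos t0)).
      2:{ rewrite <- Rmult_assoc, HL0. ring. }
      rewrite <- Rmult_plus_distr_l, E. ring.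
    - rewrite Hal. unfold c.
      replace ((V al * sin t0 + Q al * cos t0) / p al * (p al * cos t0)) with
        (V al * cos t0 * sin t0 + Q al * (cos t0 * cos t0)) by (field; lra).
      rewrite HL0.
      replace (Q al * sin t0 * sin t0 + Q al * (cos t0 * cos t0)) with
        (Q al * (sin t0 * sin t0 + cos t0 * cos t0)) by ring.
      rewrite E. ring. }
  assert (Hc : c <> 0).
  { intros Ec. apply HVx0. rewrite (proj1 (U x0 Hx0)), Ec. ring. }
  split; [|exists c; split; trivial; intros x Hx; now apply U].
  destruct (U be) as [U1 U2]; [lra|]. rewrite U1, U2 in HR0.
  rewrite sin_minus. assert (Hpb := Hp be).
  apply Rmult_eq_reg_l with (c * p be); [lra|].
  apply Rmult_integral_contrapositive_currified; lra.
Qed.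

Lemma angle_is_eigenvalue r theta :
  prufer_angle k g l r theta -> theta al = t0 -> sin (theta be - gam) = 0 ->
  is_eigenvalue al be K G L h H r.
Proof.
  intros Ht Hal Hbe.
  destruct (prufer_amplitude k g l M HC r theta Ht) as [p [Hp [Hu Hq]]].
  set (u := fun x => p x * sin (theta x)) in *. set (q := fun x => p x * cos (theta x)) in *.
  assert (HKp : forall x, al <= x <= be -> 0 < K x).
  { intros x Hx. rewrite <- Hk by trivial. apply (coef_kpos _ _ _ _ HC). }
  assert (HQ : forall x, al <= x <= be -> K x * (q x / k x) = q x).
  { intros x Hx. specialize (HKp x Hx). rewrite Hk by trivial. field. lra. }
  exists u. split.
  - (* otherwise the derivative would vanish too, and the sine and cosine of the angle would
       have a common zero *)
    apply Classical_Prop.NNPP. intros N.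
    assert (Z : forall x, al <= x <= be -> sin (theta x) = 0).
    { intros x Hx. apply Classical_Prop.NNPP. intros Hx'. apply N. exists x. split; trivial.
      unfold u. specialize (Hp x). apply Rmult_integral_contrapositive_currified; lra. }
    set (x := (al + be) / 2).
    assert (Hd : 0 < (be - al) / 2) by lra.
    assert (D1 := Hu x).
    assert (D2 : is_derive u x 0).
    { apply is_derive_ext_loc with (fun _ => 0).
      - exists (mkposreal _ Hd). intros t Htt. apply Rabs_def2 in Htt. simpl in Htt.
        unfold minus, plus, opp in Htt; simpl in Htt. unfold x in Htt.
        unfold u. rewrite Z by lra. now rewrite Rmult_0_r.
      - apply (@is_derive_const R_AbsRing R_NormedModule). }
    apply is_derive_unique in D2. rewrite (is_derive_unique u x _ D1) in D2.
    assert (E := sin2_cos2 (theta x)). unfold Rsqr in E.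
    rewrite Z in E by (unfold x; lra). specialize (Hp x).
    assert (Hkx := coef_kinv_pos k g l M HC x).
    unfold Rdiv in D2. apply Rmult_integral in D2. destruct D2 as [D2|D2]; [|lra].
    apply Rmult_integral in D2. destruct D2 as [D2|D2]; [lra|]. rewrite D2 in E. lra.
  - exists (fun x => q x / k x). repeat split.
    + intros x Hx. exact (is_derive_in_of_derive al be u u x _ Hx (fun _ _ => eq_refl) (Hu x)).
    + intros x Hx. exists ((l x - r * g x) * u x). split.
      * exact (is_derive_in_of_derive al be _ q x _ Hx HQ (Hq x)).
      * rewrite Hg, Hl by trivial. ring.
    + apply Hh. rewrite HQ by lra. unfold u, q. rewrite Hal. ring.
    + apply HH. rewrite HQ by lra. unfold u, q.
      rewrite sin_minus in Hbe.
      replace (p be * sin (theta be) * cos gam) with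
       (p be * (sin (theta be) * cos gam - cos (theta be) * sin gam) +
          p be * cos (theta be) * sin gam) by ring.
      rewrite Hbe. ring.
Qed.

Variables (rho : nat -> R) (V : nat -> R -> R).
Hypothesis Hrho : enumerates_eigenvalues al be K G L h H rho.
Hypothesis HV : forall j, (1 <= j)%nat ->
          is_eigenfunction al be K G L h H (rho j) (V j).

Lemma eigenfunctions_prufer : exists (theta p : nat -> R -> R) (c : nat -> R),
  forall j, (1 <= j)%nat ->
    prufer_angle k g l (rho j) (theta j) /\ theta j al = t0 /\
    theta j be = gam + INR (j - 1) * PI /\
    (forall x, 0 < p j x) /\
    (forall x, is_derive (fun x => p j x * sin (theta j x)) x (p j x * cos (theta j x) / k x)) /\
    (forall x, is_derive (fun x => p j x * cos (theta j x)) x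
                 ((l x - rho j * g x) * (p j x * sin (theta j x)))) /\
    c j <> 0 /\ forall x, al <= x <= be -> V j x = c j * (p j x * sin (theta j x)).
Proof.
  assert (HPI := PI_RGT_0).
  destruct (functional_choice (fun r theta => theta al = t0 /\ prufer_angle k g l r theta))
    as [th Hth].
  { intros r. destruct (prufer_angle_exists k g l M HC r al t0) as [theta Ht]. now exists theta. }
  destruct (functional_choice (fun r p => (forall x, 0 < p x) /\
    (forall x, is_derive (fun x => p x * sin (th r x)) x (p x * cos (th r x) / k x)) /\
    (forall x, is_derive (fun x => p x * cos (th r x)) x
                 ((l x - r * g x) * (p x * sin (th r x)))))) as [p Hp].
  { intros r. apply (prufer_amplitude k g l M HC), Hth. }
  set (T := fun r => th r be).
  assert (HT : forall j, T (rho (S j)) = gam + INR j * PI).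
  { apply eigenvalue_index.
    - intros r e He.
      set (E := exp ((4 * (Rabs r + 2) * M + M) * (be - al))).
      assert (HE : 1 <= E).
      { assert (HM := coef_M_pos k g l M HC). assert (Hr := Rabs_pos r).
        unfold E. assert (X := exp_ineq1_le ((4 * (Rabs r + 2) * M + M) * (be - al))).
        assert (0 <= (4 * (Rabs r + 2) * M + M) * (be - al)); [|lra].
        apply Rmult_le_pos; [|lra]. nra. }
      exists (e / E). split. apply Rdiv_lt_0_compat; lra.
      intros r' [_ Hr']. simpl in Hr' |- *. unfold R_dist in *.
      assert (X := prufer_param_close k g l M HC r r' (th r) (th r') al be
        (proj2 (Hth r)) (proj2 (Hth r')) (Rlt_le _ _ Hab)).
      rewrite (proj1 (Hth r)), (proj1 (Hth r')) in X. specialize (X eq_refl).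
      fold E in X. rewrite Rabs_minus_sym. rewrite Rabs_minus_sym in Hr'.
      unfold T. rewrite (pow2_abs_eq (_ - th r' be)), (pow2_abs_eq (r - r')) in X.
      assert (Hr2 : Rabs (r - r') * E < e).
      { replace e with (e / E * E) by (field; lra). apply Rmult_lt_compat_r; lra. }
      assert (A1 := Rabs_pos (r - r')). assert (A2 := Rabs_pos (th r be - th r' be)).
      destruct (Rlt_le_dec (Rabs (th r be - th r' be)) e) as [|N]; trivial. exfalso.
      assert (Rabs (r - r') ^ 2 * E <= (Rabs (r - r') * E) ^ 2).
      { replace ((Rabs (r - r') * E) ^ 2) with (Rabs (r - r') ^ 2 * (E * E)) by ring.
        apply Rmult_le_compat_l; [apply pow2_ge_0|nra]. }
      assert ((Rabs (r - r') * E) ^ 2 < e ^ 2).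
      { assert (0 <= Rabs (r - r') * E) by (apply Rmult_le_pos; lra). nra. }
      assert (e ^ 2 <= Rabs (th r be - th r' be) ^ 2) by nra.
      lra.
    - intros r r' Hr. apply (prufer_strict_mono k g l M HC r r' (th r) (th r') al be); trivial;
      try apply Hth. rewrite (proj1 (Hth r)). symmetry. apply Hth.
    - assert (th 0 be <= PI / 2); [|unfold T; lra].
      apply (prufer_angle_le_PI2 k g l M HC (th 0) al be); trivial. apply Hth.
      rewrite (proj1 (Hth 0)). lra.
    - apply Hrho.
    - intros r. rewrite <- (proj2 Hrho). split.
      + intros [i Hi]. apply (angle_is_eigenvalue r (th r)); try apply Hth.
        apply sin_eq_0_IZR. exists (Z.of_nat i). rewrite <- INR_IZR_INZ. unfold T in Hi. lra.
      + intros [W HW].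
        destruct (eigenfunction_multiple r W (th r) (p r) HW) as [E _]; try apply Hth; try apply Hp.
        apply sin_eq_0_IZR in E. destruct E as [i Hi].
        assert (0 < th r be).
        { assert (X := prufer_crossing_multiple k g l M HC r (th r) 0 al be (proj2 (Hth r)) Hab).
          rewrite (proj1 (Hth r)) in X. lra. }
        assert (0 <= i)%Z.
        { assert (-1 < IZR i)%R by nra. apply lt_IZR in H1. lia. }
        exists (Z.to_nat i). rewrite INR_IZR_INZ, Z2Nat.id by trivial. unfold T. lra. }
  destruct (functional_choice (fun j c => (1 <= j)%nat -> c <> 0 /\
     forall x, al <= x <= be -> V j x = c * (p (rho j) x * sin (th (rho j) x)))) as [c Hc].
  { intros j. destruct (le_lt_dec 1 j) as [L1|L1]; [|exists 0; lia].
    destruct (eigenfunction_multiple (rho j) (V j) (th (rho j)) (p (rho j)) (HV j L1))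
      as [_ [c Hc]]; try apply Hth; try apply Hp. now exists c. }
  exists (fun j => th (rho j)), (fun j => p (rho j)), c. intros j Hj.
  repeat split; try apply Hth; try apply Hp; try now apply Hc.
  replace j with (S (j - 1)) at 1 by lia. apply HT.
Qed.
End Spectrum.

(** * Smoothness, order of vanishing, and Rolle's theorem with multiplicities *)

Lemma Derive_n_Derive f n x : Derive_n (Derive f) n x = Derive_n f (S n) x.
Proof. replace (S n) with (n + 1)%nat by lia. rewrite <- Derive_n_comp. reflexivity. Qed.

Lemma locally_interval (a b x : R) : a < x < b -> locally x (fun t => a < t < b).
Proof.
  intros Hx. assert (Hm : 0 < Rmin (x - a) (b - x)) by (apply Rmin_pos; lra).
  exists (mkposreal _ Hm). intros t Ht. apply Rabs_def2 in Ht. simpl in Ht.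
  unfold minus, plus, opp in Ht; simpl in Ht.
  assert (H1 := Rmin_l (x - a) (b - x)). assert (H2 := Rmin_r (x - a) (b - x)). lra.
Qed.

Section Smooth.
Variables a b : R.

(** Differentiability conditions bear on the open interval only, because the extended coefficients have
corners at the endpoints. *)
Fixpoint Cn (n : nat) (f : R -> R) : Prop :=
  match n with
  | O => True
  | S n => (forall x, a < x < b -> ex_derive f x) /\ Cn n (Derive f)
  end.

Definition vanish (p : nat) (f : R -> R) (x : R) : Prop :=
  forall i, (i < p)%nat -> Derive_n f i x = 0.

Lemma locally_eq (f g : R -> R) x : (forall t, a < t < b -> f t = g t) -> a < x < b ->
  locally x (fun t => f t = g t).
Proof.
  intros H Hx. eapply filter_imp; [|apply (locally_interval a b x Hx)]. auto.
Qed.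

Lemma Derive_eq (f g : R -> R) : (forall t, a < t < b -> f t = g t) ->
  forall t, a < t < b -> Derive f t = Derive g t.
Proof. intros H t Ht. apply Derive_ext_loc. now apply locally_eq. Qed.

Lemma Cn_ext n (f g : R -> R) : (forall x, a < x < b -> f x = g x) -> Cn n f -> Cn n g.
Proof.
  revert f g. induction n; intros f g E H; simpl; trivial.
  destruct H as [H1 H2]. split.
  - intros x Hx. apply ex_derive_ext_loc with f; auto. now apply locally_eq.
  - apply IHn with (Derive f); trivial. now apply Derive_eq.
Qed.

Lemma Cn_weaken n f : Cn (S n) f -> Cn n f.
Proof.
  revert f. induction n; intros f H; simpl; trivial.
  destruct H as [H1 H2]. split; trivial. apply IHn. exact H2.
Qed.

Lemma Cn_const n c : Cn n (fun _ => c).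
Proof.
  revert c. induction n; intros c; simpl; trivial. split.
  - intros x _. apply ex_derive_const.
  - apply Cn_ext with (fun _ => 0); trivial. intros x _. now rewrite Derive_const.
Qed.

Lemma Cn_plus n f g : Cn n f -> Cn n g -> Cn n (fun x => f x + g x).
Proof.
  revert f g. induction n; intros f g Hf Hg; simpl; trivial.
  destruct Hf as [Hf1 Hf2], Hg as [Hg1 Hg2]. split.
  - intros x Hx. apply (ex_derive_plus f g); auto.
  - apply Cn_ext with (fun x => Derive f x + Derive g x); auto.
    intros x Hx. now rewrite Derive_plus; auto.
Qed.

Lemma Cn_mult n f g : Cn n f -> Cn n g -> Cn n (fun x => f x * g x).
Proof.
  revert f g. induction n; intros f g Hf Hg; simpl; trivial.
  assert (Hf' := Cn_weaken _ _ Hf). assert (Hg' := Cn_weaken _ _ Hg).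
  destruct Hf as [Hf1 Hf2], Hg as [Hg1 Hg2]. split.
  - intros x Hx. apply (ex_derive_mult f g); auto.
  - apply Cn_ext with (fun x => Derive f x * g x + f x * Derive g x).
    + intros x Hx. now rewrite Derive_mult; auto.
    + apply Cn_plus; auto.
Qed.

Lemma Cn_opp n f : Cn n f -> Cn n (fun x => - f x).
Proof.
  intros H. apply Cn_ext with (fun x => -1 * f x). intros; ring.
  apply Cn_mult; trivial. apply Cn_const.
Qed.

Lemma Cn_minus n f g : Cn n f -> Cn n g -> Cn n (fun x => f x - g x).
Proof. intros. apply Cn_plus; trivial. now apply Cn_opp. Qed.

Lemma Cn_inv n f : (forall x, a < x < b -> f x <> 0) -> Cn n f -> Cn n (fun x => / f x).
Proof.
  intros H0. induction n; intros Hf; simpl; trivial.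
  assert (Hf' := Cn_weaken _ _ Hf). destruct Hf as [Hf1 Hf2]. split.
  - intros x Hx. apply ex_derive_inv; auto.
  - apply Cn_ext with (fun x => - Derive f x * (/ f x * / f x)).
    + intros x Hx. rewrite Derive_inv; auto. field. auto.
    + apply Cn_mult; auto using Cn_opp, Cn_mult.
Qed.

Lemma Cn_of_ex_derive_n f : (forall n x, a < x < b -> ex_derive_n f n x) -> forall n, Cn n f.
Proof.
  intros H n. revert f H. induction n; intros f H; simpl; trivial. split.
  - exact (H 1%nat).
  - apply IHn. intros m x Hx. destruct m; [exact I|].
    apply ex_derive_ext with (Derive_n f (S m)). intros t. symmetry; apply Derive_n_Derive.
    exact (H (S (S m)) x Hx).
Qed.

Lemma Cn_ex_derive_n n f x : Cn n f -> a < x < b -> ex_derive_n f n x.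
Proof.
  revert f. induction n; intros f Hf Hx; simpl; trivial.
  destruct Hf as [H1 H2]. destruct n. now apply H1.
  apply ex_derive_ext with (Derive_n (Derive f) n). apply Derive_n_Derive.
  exact (IHn _ H2 Hx).
Qed.

Lemma vanish_S p f x : vanish (S p) f x <-> f x = 0 /\ vanish p (Derive f) x.
Proof.
  split.
  - intros H. split. exact (H 0%nat ltac:(lia)).
    intros i Hi. rewrite Derive_n_Derive. apply H. lia.
  - intros [H1 H2] i Hi. destruct i; [exact H1|]. rewrite <- Derive_n_Derive.
    apply H2. lia.
Qed.

Lemma vanish_ext p (f g : R -> R) x : (forall t, a < t < b -> f t = g t) -> a < x < b ->
  vanish p f x -> vanish p g x.
Proof.
  intros E Hx H i Hi. rewrite <- (H i Hi). symmetry. apply Derive_n_ext_loc.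
  now apply locally_eq.
Qed.

Lemma vanish_le p q f x : (p <= q)%nat -> vanish q f x -> vanish p f x.
Proof. intros Hpq H i Hi. apply H. lia. Qed.

Lemma vanish_plus p f g x : a < x < b -> Cn p f -> Cn p g ->
  vanish p f x -> vanish p g x -> vanish p (fun x => f x + g x) x.
Proof.
  intros Hx. revert f g. induction p; intros f g Cf Cg Hf Hg; [intros i Hi; lia|].
  apply vanish_S in Hf, Hg. destruct Hf as [Hf1 Hf2], Hg as [Hg1 Hg2].
  destruct Cf as [Cf1 Cf2], Cg as [Cg1 Cg2].
  apply vanish_S. split; [lra|].
  apply vanish_ext with (fun x => Derive f x + Derive g x); auto.
  intros t Ht. now rewrite Derive_plus; auto.
Qed.

Lemma vanish_mult p f g x : a < x < b -> Cn p f -> Cn p g ->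
  vanish p f x -> vanish p (fun x => f x * g x) x.
Proof.
  intros Hx. revert f g. induction p; intros f g Cf Cg Hf; [intros i Hi; lia|].
  assert (Hf' : vanish p f x) by (eapply vanish_le; [|apply Hf]; lia).
  apply vanish_S in Hf. destruct Hf as [Hf1 Hf2].
  assert (Cf' := Cn_weaken _ _ Cf). assert (Cg' := Cn_weaken _ _ Cg).
  destruct Cf as [Cf1 Cf2], Cg as [Cg1 Cg2].
  apply vanish_S. split; [rewrite Hf1; ring|].
  apply vanish_ext with (fun x => Derive f x * g x + f x * Derive g x); auto.
  - intros t Ht. now rewrite Derive_mult; auto.
  - apply vanish_plus; auto using Cn_mult.
Qed.
End Smooth.

Notation mult_in l x := (count_occ Req_EM_T l x).

Lemma sort_exists (l : list R) : exists l', Permutation l l' /\ Sorted Rle l'.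
Proof.
  induction l as [|x l [l' [P S]]]; [exists nil; auto|].
  assert (I : forall s, Sorted Rle s -> exists s', Permutation (x :: s) s' /\ Sorted Rle s' /\
     (forall y, y <= x -> HdRel Rle y s -> HdRel Rle y s')).
  { induction s as [|y s IH]; intros Hs.
    - exists (x :: nil). split; [|split]; auto.
    - destruct (Rle_lt_dec x y) as [L|L].
      + exists (x :: y :: s). split; [|split]; auto.
      + apply Sorted_inv in Hs. destruct Hs as [Hs Hy].
        destruct (IH Hs) as [s' [P' [S' H']]].
        exists (y :: s'). split; [|split].
        * eapply perm_trans; [apply perm_swap|]. now apply perm_skip.
        * apply Sorted_cons; trivial. apply H'; trivial. lra.
        * intros z Hz Hzz. inversion Hzz; subst. now constructor. }
  destruct (I l' S) as [s' [P' [S' _]]]. exists s'. split; trivial.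
  eapply perm_trans; [apply perm_skip, P|exact P'].
Qed.

Definition hull (l : list R) (x : R) : Prop := exists y z, In y l /\ In z l /\ y <= x <= z.

(** For [y0 <= y1 <= ...] a zero of [f'] is chosen between any two neighbours: their common value if
they coincide, a Rolle point strictly between them otherwise. A point of multiplicity [p] is thus
kept [p - 1] times, and each new point appears once. The statement speaks of counts rather than of
derivatives of higher order so that the induction, which splits multiple points, goes through. *)
Lemma rolle_sorted (f : R -> R) (l : list R) (y0 : R) :
  Sorted Rle (y0 :: l) ->
  (forall x, In x (y0 :: l) -> f x = 0) ->
  (forall x, hull (y0 :: l) x -> ex_derive f x) ->
  exists l', length l' = length l /\
    (forall x, In x l' -> y0 <= x /\ hull (y0 :: l) x) /\
    (forall x, In x (y0 :: l) -> (S (mult_in l' x) <= mult_in (y0 :: l) x)%nat) /\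
    (forall x, ~ In x (y0 :: l) -> (mult_in l' x <= 1)%nat) /\
    (forall x, In x l' -> ~ In x (y0 :: l) -> Derive f x = 0).
Proof.
  revert y0. induction l as [|y1 l IH]; intros y0 HS H0 Hd.
  - exists nil. split; [|split; [|split; [|split]]]; try easy.
    + intros x [->|[]]. simpl. destruct (Req_EM_T x x); [lia|easy].
    + intros x _. simpl. lia.
  - apply Sorted_inv in HS. destruct HS as [HS Hy]. inversion Hy as [|? ? Hy01]; subst.
    assert (Hh : forall x, hull (y1 :: l) x -> hull (y0 :: y1 :: l) x).
    { intros x [y [z [Iy [Iz Hx]]]]. exists y, z. simpl in *; tauto. }
    destruct (IH y1 HS) as [l' [Hlen [Hloc [Hin [Hnin Hder]]]]].
    { intros x Hx. apply H0. now right. }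
    { intros x Hx. apply Hd. now apply Hh. }
    destruct (Rle_lt_or_eq_dec _ _ Hy01) as [Hlt|<-].
    + assert (pr : forall x, y0 < x < y1 -> derivable_pt f x).
      { intros x Hx. apply ex_derive_Reals_0, Hd. exists y0, y1. simpl.
        split; [|split]; auto; lra. }
      destruct (Rolle f y0 y1 pr) as [z [Hz Ez]]; trivial.
      { intros x Hx. destruct (Hd x) as [d Hdx].
        - exists y0, y1. simpl. split; [|split]; auto.
        - eapply is_derive_continuity_pt, Hdx. }
      { rewrite !H0; simpl; auto. }
      rewrite Derive_Reals in Ez.
      assert (Hge : forall x, In x l' -> y1 <= x) by (intros x Hx; now apply Hloc).
      assert (HS' : List.Forall (Rle y1) l).
      { apply Sorted_extends in HS; trivial. intros u v w; apply Rle_trans. }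
      assert (Hz0 : ~ In z (y0 :: y1 :: l)).
      { intros [E|[E|E]]; try lra. rewrite List.Forall_forall in HS'. specialize (HS' z E). lra. }
      assert (Hz' : ~ In z l') by (intros E; specialize (Hge z E); lra).
      exists (z :: l'). split; [simpl; auto|split; [|split; [|split]]].
      * intros x [<-|Hx].
        -- split; [lra|]. exists y0, y1. simpl. split; [|split]; auto; lra.
        -- split; [specialize (Hge x Hx); lra|]. now apply Hh, Hloc.
      * intros x Hx. assert (Nx : z <> x) by congruence.
        simpl (mult_in (z :: l') x). destruct (Req_EM_T z x); [easy|].
        change (mult_in (y0 :: y1 :: l) x) with
          (if Req_EM_T y0 x then S (mult_in (y1 :: l) x) else mult_in (y1 :: l) x).
        destruct (Req_EM_T y0 x) as [E|E].
        -- subst x. assert (mult_in l' y0 = 0)%nat; [|lia].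
           apply count_occ_not_In. intros E. specialize (Hge _ E). lra.
        -- apply Hin. destruct Hx as [Hx|Hx]; easy.
      * intros x Hx. simpl. destruct (Req_EM_T z x) as [->|E].
        -- rewrite (proj1 (count_occ_not_In Req_EM_T l' x)); auto.
        -- apply Hnin. simpl in *; tauto.
      * intros x [<-|Hx] Hx'; trivial. apply Hder; trivial. simpl in *; tauto.
    + exists (y0 :: l'). split; [simpl; auto|split; [|split; [|split]]].
      * intros x [<-|Hx].
        -- split; [lra|]. exists y0, y0. simpl. split; [|split]; auto; lra.
        -- split; [now apply Hloc|]. now apply Hh, Hloc.
      * intros x Hx. specialize (Hin x).
        change (mult_in (y0 :: y0 :: l) x) with
          (if Req_EM_T y0 x then S (mult_in (y0 :: l) x) else mult_in (y0 :: l) x).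
        simpl (mult_in (y0 :: l') x). destruct (Req_EM_T y0 x) as [E|E].
        -- apply le_n_S, Hin. now left.
        -- apply Hin. destruct Hx as [Hx|Hx]; easy.
      * intros x Hx. simpl. destruct (Req_EM_T y0 x) as [E|E]; [simpl in Hx; tauto|].
        apply Hnin. simpl in *; tauto.
      * intros x [<-|Hx] Hx'; [simpl in Hx'; tauto|]. apply Hder; trivial. simpl in *; tauto.
Qed.

(** A list encodes zeros with multiplicities by repetition. The clause [2 <= mult_in l x] records that
a point of [l] survives only if it is repeated; it excludes simple zeros at the endpoints. *)
Lemma rolle_multiplicities (f : R -> R) (l : list R) :
  (forall x, vanish (mult_in l x) f x) ->
  (forall x, hull l x -> ex_derive f x) ->
  exists l', length l' = pred (length l) /\
    (forall x, In x l' -> hull l x /\ (In x l -> (2 <= mult_in l x)%nat)) /\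
    (forall x, vanish (mult_in l' x) (Derive f) x).
Proof.
  intros Hv Hd. destruct (sort_exists l) as [s [P HS]].
  assert (Hcount : forall x, mult_in l x = mult_in s x).
  { intros x. apply (proj1 (Permutation_count_occ Req_EM_T l s) P). }
  destruct s as [|y0 s].
  { apply Permutation_sym, Permutation_nil in P. subst l. exists nil. split; [|split]; try easy. }
  assert (Hh : forall x, hull (y0 :: s) x <-> hull l x).
  { intros x. split; intros [y [z [Iy [Iz Hx]]]]; exists y, z; split; [|split| |split]; trivial;
    try (eapply Permutation_in; [apply Permutation_sym|]; eauto);
    try (eapply Permutation_in; eauto). }
  destruct (rolle_sorted f s y0) as [l' [Hlen [Hloc [Hin [Hnin Hder]]]]]; trivial.
  { intros x Hx. apply (Hv x 0%nat). rewrite Hcount.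
    now apply count_occ_In. }
  { intros x Hx. now apply Hd, Hh. }
  exists l'. split; [|split].
  - rewrite Hlen, (Permutation_length P). reflexivity.
  - intros x Hx. split; [apply Hh, Hloc, Hx|]. intros Hxl. rewrite Hcount.
    assert (Hxs : In x (y0 :: s)) by (eapply Permutation_in; eauto).
    apply (count_occ_In Req_EM_T) in Hx. specialize (Hin x Hxs). lia.
  - intros x. destruct (in_dec Req_EM_T x (y0 :: s)) as [Hx|Hx].
    + specialize (Hin x Hx). specialize (Hv x). rewrite Hcount in Hv.
      destruct (mult_in (y0 :: s) x) as [|p]; [lia|].
      apply vanish_S in Hv. eapply vanish_le; [|apply Hv]. lia.
    + specialize (Hnin x Hx). intros i Hi. destruct i; [|lia].
      apply Hder; trivial. apply (count_occ_In Req_EM_T). lia.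
Qed.

(** * One application of the differential operator does not lose zeros *)

Definition has_zeros (a b : R) (f : R -> R) (zs : list R) : Prop :=
  (forall x, In x zs -> a < x < b) /\ forall x, vanish (mult_in zs x) f x.

Lemma vanish_count0 zs f x : ~ In x zs -> vanish (mult_in zs x) f x.
Proof.
  intros H i Hi. rewrite (proj1 (count_occ_not_In Req_EM_T zs x) H) in Hi. lia.
Qed.

(** With [W = u1 * qy - y * q1], the quotient [y / u1] has derivative [W / (k * u1^2)], and
[W' = - g * u1 * z], the terms in [l] and [r1] cancelling. Two applications of Rolle's theorem
lose two zeros, and [W] has two extra ones at the endpoints. *)
Lemma sturm_step (al be : R) (k g l : R -> R) (u1 q1 y qy z : R -> R) (r1 : R) (zs : list R) :
  al < be ->
  (forall x, 0 < k x) -> (forall x, 0 < g x) ->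
  (forall n, Cn al be n k) -> (forall n, Cn al be n g) ->
  (forall n, Cn al be n u1) -> (forall n, Cn al be n q1) ->
  (forall n, Cn al be n y) -> (forall n, Cn al be n qy) ->
  (forall x, is_derive u1 x (q1 x / k x)) ->
  (forall x, is_derive q1 x ((l x - r1 * g x) * u1 x)) ->
  (forall x, is_derive y x (qy x / k x)) ->
  (forall x, is_derive qy x (l x * y x - g x * (z x + r1 * y x))) ->
  (forall x, al < x < be -> u1 x <> 0) ->
  u1 al * qy al = y al * q1 al -> u1 be * qy be = y be * q1 be ->
  has_zeros al be y zs ->
  exists zs', length zs' = length zs /\ has_zeros al be z zs'.
Proof.
  intros Hab Hk Hg Ck Cg Cu Cq Cy Cqy Hu Hq Hy Hqy Hu0 Bal Bbe [Hin Hv].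
  destruct zs as [|z0 zs0] eqn:Ezs.
  { exists nil. split; trivial. split; [intros x []|]. intros x i Hi. simpl in Hi. lia. }
  rewrite <- Ezs in *.
  assert (Hlen : length zs = S (length zs0)) by (rewrite Ezs; reflexivity).
  clear Ezs z0.
  assert (Ciu : forall n, Cn al be n (fun x => / u1 x)) by (intros; now apply Cn_inv).
  set (f := fun x => y x * / u1 x).
  set (W := fun x => u1 x * qy x - y x * q1 x).
  assert (Hf : forall x, al < x < be -> is_derive f x (W x / (k x * (u1 x * u1 x)))).
  { intros x Hx. specialize (Hu0 x Hx). specialize (Hk x).
    replace (W x / (k x * (u1 x * u1 x))) with
      (qy x / k x * / u1 x + y x * (- (q1 x / k x) / (u1 x) ^ 2)).
    2:{ unfold W. field. split; lra. }
    apply (is_derive_mult y (fun x => / u1 x)); [apply Hy| |intros; apply Rmult_comm].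
    now apply is_derive_inv. }
  assert (HW : forall x, is_derive W x (- (g x * u1 x) * z x)).
  { intros x. replace (- (g x * u1 x) * z x) with
     ((q1 x / k x * qy x + u1 x * (l x * y x - g x * (z x + r1 * y x))) -
      (qy x / k x * q1 x + y x * ((l x - r1 * g x) * u1 x))).
    2:{ field. apply Rgt_not_eq, Hk. }
    apply (is_derive_minus (fun x => u1 x * qy x) (fun x => y x * q1 x)).
    apply (is_derive_mult u1 qy); auto. intros; apply Rmult_comm.
    apply (is_derive_mult y q1); auto. intros; apply Rmult_comm. }
  assert (CW : forall n, Cn al be n W) by (intros; apply Cn_minus; now apply Cn_mult).
  assert (Cf : forall n, Cn al be n f) by (intros; now apply Cn_mult).
  destruct (rolle_multiplicities f zs) as [l1 [Hl1 [Hloc1 Hv1]]].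
  { intros x. destruct (in_dec Req_EM_T x zs) as [Hx|Hx].
    - apply (vanish_mult al be); auto.
    - now apply vanish_count0. }
  { intros x [s [t [Hs [Ht Hx]]]]. specialize (Hin s Hs) as Hs'. specialize (Hin t Ht) as Ht'.
    eexists. apply Hf. lra. }
  assert (Hin1 : forall x, In x l1 -> al < x < be).
  { intros x Hx. destruct (Hloc1 x Hx) as [[s [t [Hs [Ht Hst]]]] _].
    specialize (Hin s Hs) as Hs'. specialize (Hin t Ht) as Ht'. lra. }
  (* the endpoints are zeros of the Wronskian thanks to the boundary conditions, and make up
     for the zeros lost in the two applications of Rolle's theorem *)
  set (l2 := al :: be :: l1).
  destruct (rolle_multiplicities W l2) as [l3 [Hl3 [Hloc3 Hv3]]].
  { intros x. unfold l2. simpl.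
    destruct (Req_EM_T al x) as [<-|Na]; [|destruct (Req_EM_T be x) as [<-|Nb]].
    - destruct (Req_EM_T be al); [lra|].
      rewrite (proj1 (count_occ_not_In Req_EM_T l1 al)).
      2:{ intros E. specialize (Hin1 _ E). lra. }
      intros i Hi. destruct i; [|lia]. simpl. unfold W. lra.
    - rewrite (proj1 (count_occ_not_In Req_EM_T l1 be)).
      2:{ intros E. specialize (Hin1 _ E). lra. }
      intros i Hi. destruct i; [|lia]. simpl. unfold W. lra.
    - destruct (in_dec Req_EM_T x l1) as [Hx|Hx]; [|now apply vanish_count0].
      apply (vanish_ext al be) with (fun x => Derive f x * (k x * (u1 x * u1 x))); auto.
      + intros t Ht. rewrite (is_derive_unique _ _ _ (Hf t Ht)). field.
        split. now apply Hu0. apply Rgt_not_eq, Hk.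
      + apply (vanish_mult al be); auto. apply (Cf (S _)).
        repeat apply Cn_mult; auto. }
  { intros x _. eexists. apply HW. }
  assert (Hin3 : forall x, In x l3 -> al < x < be).
  { intros x Hx. destruct (Hloc3 x Hx) as [[s [t [Hs [Ht Hst]]]] Hm].
    assert (R : forall v, In v l2 -> al <= v <= be).
    { intros v [<-|[<-|Hv']]; try lra. specialize (Hin1 v Hv'). lra. }
    specialize (R s Hs) as Rs. specialize (R t Ht) as Rt.
    split.
    - destruct (Req_dec al x) as [<-|N]; [exfalso|lra].
      specialize (Hm ltac:(now left)). unfold l2 in Hm. simpl in Hm.
      destruct (Req_EM_T al al); [|easy]. destruct (Req_EM_T be al); [lra|].
      rewrite (proj1 (count_occ_not_In Req_EM_T l1 al)) in Hm; [lia|].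
      intros E. specialize (Hin1 _ E). lra.
    - destruct (Req_dec be x) as [<-|N]; [exfalso|lra].
      specialize (Hm ltac:(right; now left)). unfold l2 in Hm. simpl in Hm.
      destruct (Req_EM_T al be); [lra|]. destruct (Req_EM_T be be); [|easy].
      rewrite (proj1 (count_occ_not_In Req_EM_T l1 be)) in Hm; [lia|].
      intros E. specialize (Hin1 _ E). lra. }
  exists l3. split.
  - rewrite Hl3. unfold l2. simpl. rewrite Hl1, Hlen. reflexivity.
  - split; trivial. intros x. destruct (in_dec Req_EM_T x l3) as [Hx|Hx]; [|now apply vanish_count0].
    apply (vanish_ext al be) with (fun x => Derive W x * (- / g x * / u1 x)); auto.
    + intros t Ht. rewrite (is_derive_unique _ _ _ (HW t)). field.
      split. now apply Hu0. apply Rgt_not_eq, Hg.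
    + apply (vanish_mult al be); auto. apply (CW (S _)).
      apply Cn_mult; auto. apply Cn_opp, Cn_inv; auto. intros; apply Rgt_not_eq, Hg.
Qed.

(** * Zeros of functions close to an eigenfunction *)

Lemma near_multiple_of_small_sin (t eta : R) :
  0 < eta <= PI / 2 -> Rabs (sin t) < sin eta -> exists i : Z, Rabs (t - IZR i * PI) < eta.
Proof.
  intros He Hs. assert (HPI := PI_RGT_0).
  (* this [i] is the integer nearest to [t / PI], so that [s] lies where the sine is monotone *)
  destruct (archimed (t / PI - 1 / 2)) as [U1 U2].
  set (i := up (t / PI - 1 / 2)) in *.
  exists i. set (s := t - IZR i * PI).
  assert (Ht : t = t / PI * PI) by (field; lra).
  assert (Hs1 : - (PI / 2) <= s <= PI / 2).
  { unfold s. rewrite Ht at 1 2. split; nra. }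
  assert (Es : Rabs (sin t) = Rabs (sin s)).
  { assert (S0 : sin (IZR i * PI) = 0) by (apply sin_eq_0_IZR; eauto).
    assert (C1 := sin2_cos2 (IZR i * PI)). unfold Rsqr in C1. rewrite S0 in C1.
    replace t with (s + IZR i * PI) by (unfold s; ring).
    rewrite sin_plus, S0, Rmult_0_r, Rplus_0_r, Rabs_mult.
    assert (Rabs (cos (IZR i * PI)) = 1); [|nra].
    assert (cos (IZR i * PI) = 1 \/ cos (IZR i * PI) = -1) as [-> | ->].
    { assert ((cos (IZR i * PI) - 1) * (cos (IZR i * PI) + 1) = 0) by lra.
      apply Rmult_integral in H. lra. }
    apply Rabs_R1. rewrite Rabs_left; lra. }
  rewrite Es in Hs. apply Rabs_def2 in Hs.
  apply Rabs_def1.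
  - destruct (Rlt_le_dec s eta) as [|N]; trivial. exfalso.
    assert (sin eta <= sin s) by (apply sin_incr_1; lra). lra.
  - destruct (Rlt_le_dec (- eta) s) as [|N]; trivial. exfalso.
    assert (sin s <= sin (- eta)) by (apply sin_incr_1; lra). rewrite sin_neg in H. lra.
Qed.

Lemma min_pos (f : R -> R) a b : a <= b -> (forall x, a <= x <= b -> continuity_pt f x) ->
  (forall x, 0 < f x) -> exists m, 0 < m /\ forall x, a <= x <= b -> m <= f x.
Proof.
  intros Hab Hc Hp. destruct (continuity_ab_min f a b Hab Hc) as [x0 [H1 _]].
  exists (f x0). split; auto.
Qed.

Lemma Derive_zero_between (f df : R -> R) s t : s < t ->
  (forall x, is_derive f x (df x)) -> f s = 0 -> f t = 0 -> exists w, s < w < t /\ df w = 0.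
Proof.
  intros Hst Hd Hs Ht.
  assert (pr : forall x, s < x < t -> derivable_pt f x).
  { intros x _. apply ex_derive_Reals_0. eexists; apply Hd. }
  destruct (Rolle f s t pr) as [w [Hw Ew]]; trivial; try lra.
  { intros x _. eapply is_derive_continuity_pt, Hd. }
  exists w. split; trivial. rewrite Derive_Reals in Ew.
  now rewrite (is_derive_unique _ _ _ (Hd w)) in Ew.
Qed.

Section Near.
Variables (k g l : R -> R) (M al be r t0 gam : R) (theta p : R -> R) (j : nat).
Hypothesis HC : coefs k g l M.
Hypothesis Hab : al < be.
Hypothesis Ht0 : 0 <= t0 <= PI / 2.
Hypothesis Hgam : PI / 2 <= gam <= PI.
Hypothesis Hth : prufer_angle k g l r theta.
Hypothesis Hal : theta al = t0.
Hypothesis Hbe : theta be = gam + INR j * PI.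
Hypothesis Hp : forall x, 0 < p x.
Hypothesis Hpc : forall x, continuity_pt p x.

(** Between two zeros of [y], Rolle's theorem gives a zero of [qy], where the angle is close to an odd
multiple of [PI / 2]. As the levels close to [i * PI] are crossed upwards only, the angle cannot
come back to [i * PI], so the next zero belongs to a larger multiple. *)
Lemma angle_index_mono (eta : R) (y qy : R -> R) :
  0 < eta <= PI / 4 ->
  (forall c (i : Z) s t, al <= s -> t <= be -> s < t -> Rabs (c - IZR i * PI) <= eta ->
      c <= theta s -> c < theta t) ->
  (forall x, is_derive y x (qy x / k x)) ->
  (forall x, al <= x <= be -> qy x = 0 ->
     exists i : Z, Rabs (theta x - PI / 2 - IZR i * PI) < eta) ->
  forall s t (i i' : Z), al <= s -> t <= be -> s < t -> y s = 0 -> y t = 0 ->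
   Rabs (theta s - IZR i * PI) < eta -> Rabs (theta t - IZR i' * PI) < eta -> (i < i')%Z.
Proof.
  intros He Hcr Hy Hq s t i i' Hs Ht Hst Ys Yt Is It. assert (HPI := PI_RGT_0).
  destruct (Derive_zero_between y (fun x => qy x / k x) s t) as [w [Hw Qw]]; trivial.
  assert (Hkw := coef_kpos _ _ _ _ HC w).
  assert (Qw' : qy w = 0).
  { replace (qy w) with (qy w / k w * k w) by (field; lra). rewrite Qw. ring. }
  destruct (Hq w ltac:(lra) Qw') as [m Hm].
  apply Rabs_def2 in Is. apply Rabs_def2 in It. apply Rabs_def2 in Hm.
  assert (C1 : IZR i * PI - eta < theta w).
  { apply (Hcr _ i s w); try lra. apply Rabs_le. lra. }
  assert (Him : (i <= m)%Z).
  { assert (IZR i < IZR m + 1) by nra. rewrite <- plus_IZR in H. apply lt_IZR in H. lia. }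
  apply IZR_le in Him.
  assert (C2 : IZR i * PI + eta < theta t).
  { apply (Hcr _ i w t); try lra. apply Rabs_le. lra. nra. }
  apply lt_IZR. nra.
Qed.

(** Where [y] vanishes the angle is close to some [i * PI], and where [qy] vanishes it is close to an
odd multiple of [PI / 2]. So the zeros of [y] are simple and belong to distinct integers [i]. The
end values of the angle restrict these to [0 < i < S j]; if an end value is itself a multiple of
[PI], the boundary condition makes the endpoint a zero of [y], to which monotonicity of the index
applies. *)
Lemma few_zeros_near : exists delta, 0 < delta /\ forall y qy : R -> R,
  (forall x, is_derive y x (qy x / k x)) ->
  y al * cos t0 = qy al * sin t0 -> y be * cos gam = qy be * sin gam ->
  (forall x, al <= x <= be -> Rabs (y x - p x * sin (theta x)) <= delta /\
                              Rabs (qy x - p x * cos (theta x)) <= delta) ->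
  forall zs, has_zeros al be y zs -> (length zs <= j)%nat.
Proof.
  assert (HPI := PI_RGT_0).
  destruct (min_pos (fun x => / k x) al be) as [m [Hm Hkm]]; [lra| |apply (coef_kinv_pos k g l M HC)|].
  { intros x _. apply continuity_pt_filterlim, (continuous_kinv k g l M HC). }
  destruct (min_pos p al be) as [pm [Hpm Hpp]]; [lra|auto|auto|].
  set (B := (Rabs r + 2) * M).
  assert (HB : 0 < B).
  { assert (X := coef_M_pos k g l M HC). assert (Y := Rabs_pos r). unfold B. nra. }
  set (e1 := if Rlt_dec 0 t0 then t0 else 1).
  set (e2 := if Rlt_dec gam PI then PI - gam else 1).
  assert (He1 : 0 < e1) by (unfold e1; destruct (Rlt_dec 0 t0); lra).
  assert (He2 : 0 < e2) by (unfold e2; destruct (Rlt_dec gam PI); lra).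
  assert (exists eta, 0 < eta /\ eta <= 1 / 2 /\ eta * B < m /\ eta <= e1 /\ eta <= e2)
    as [eta [Heta [Heta1 [HetaB [Hetae1 Hetae2]]]]].
  { (* [eta * B < m] makes the angle increase at every level within [eta] of a multiple of
       [PI]; [e1] and [e2] keep the end values of the angle, when they are not themselves
       multiples of [PI], on the right side of those levels *)
    exists (Rmin (1 / 2) (Rmin (m / B / 2) (Rmin e1 e2))).
    assert (HmB : 0 < m / B) by (apply Rdiv_lt_0_compat; lra).
    assert (X1 := Rmin_l (1 / 2) (Rmin (m / B / 2) (Rmin e1 e2))).
    assert (X2 := Rmin_r (1 / 2) (Rmin (m / B / 2) (Rmin e1 e2))).
    assert (X3 := Rmin_l (m / B / 2) (Rmin e1 e2)).
    assert (X4 := Rmin_r (m / B / 2) (Rmin e1 e2)).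
    assert (X5 := Rmin_l e1 e2). assert (X6 := Rmin_r e1 e2).
    split; [repeat apply Rmin_pos; lra|]. repeat split; try lra.
    apply Rle_lt_trans with (m / B / 2 * B). apply Rmult_le_compat_r; lra.
    replace (m / B / 2 * B) with (m / 2) by (field; lra). lra. }
  assert (Heta4 : eta <= PI / 4). { assert (X := PI2_3_2). lra. }
  assert (Hsin : 0 < sin eta) by (apply sin_gt_0; lra).
  assert (Hcr : forall c (i : Z) s t, al <= s -> t <= be -> s < t ->
     Rabs (c - IZR i * PI) <= eta -> c <= theta s -> c < theta t).
  { intros c i s t Hs Ht Hst Hc Hcs.
    apply (prufer_crossing k g l r theta c s t); trivial.
    intros z Hz. unfold prufer_field.
    assert (Hb := prufer_coef_bound k g l M HC r z). fold B in Hb.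
    assert (Hkz := Hkm z ltac:(lra)).
    assert (S0 : sin (IZR i * PI) = 0) by (apply sin_eq_0_IZR; eauto).
    assert (Hsc : Rabs (sin c) <= eta).
    { eapply Rle_trans; [|exact Hc]. eapply Rle_trans; [|apply sin_lipschitz].
      rewrite S0, Rminus_0_r. lra. }
    set (b := r * g z - l z - / k z) in *.
    assert (Hs2 : sin c ^ 2 <= eta).
    { rewrite (pow2_abs_eq (sin c)). assert (X := Rabs_pos (sin c)). nra. }
    assert (Hs0 := pow2_ge_0 (sin c)).
    apply Rabs_le_between in Hb.
    assert (- (eta * B) <= b * sin c ^ 2) by nra. lra. }
  exists (pm * sin eta / 2). split; [nra|].
  intros y qy Hy Yal Ybe Hclose zs [Hin Hv].
  assert (HA : forall x, al <= x <= be -> y x = 0 ->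
     exists i : Z, Rabs (theta x - IZR i * PI) < eta).
  { intros x Hx Yx. apply near_multiple_of_small_sin; [lra|].
    destruct (Hclose x Hx) as [X _]. specialize (Hpp x Hx). specialize (Hp x).
    rewrite Yx, Rminus_0_l, Rabs_Ropp, Rabs_mult, (Rabs_pos_eq (p x)) in X by lra.
    assert (Y := Rabs_pos (sin (theta x))).
    apply Rmult_lt_reg_l with pm; trivial. nra. }
  assert (HBq : forall x, al <= x <= be -> qy x = 0 ->
     exists i : Z, Rabs (theta x - PI / 2 - IZR i * PI) < eta).
  { intros x Hx Yx. apply near_multiple_of_small_sin; [lra|].
    destruct (Hclose x Hx) as [_ X]. specialize (Hpp x Hx). specialize (Hp x).
    rewrite Yx, Rminus_0_l, Rabs_Ropp, Rabs_mult, (Rabs_pos_eq (p x)) in X by lra.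
    replace (sin (theta x - PI / 2)) with (- cos (theta x)).
    2:{ rewrite sin_minus, cos_PI2, sin_PI2. ring. }
    rewrite Rabs_Ropp. assert (Y := Rabs_pos (cos (theta x))).
    apply Rmult_lt_reg_l with pm; trivial. nra. }
  assert (HD := angle_index_mono eta y qy (conj Heta Heta4) Hcr Hy HBq).
  destruct (functional_choice (fun (x : R) (i : Z) => al <= x <= be -> y x = 0 ->
      Rabs (theta x - IZR i * PI) < eta)) as [ix Hix].
  { intros x. destruct (Classical_Prop.classic (al <= x <= be /\ y x = 0)) as [[X Y]|N].
    - destruct (HA x X Y) as [i Hi]. eauto.
    - exists 0%Z. tauto. }
  assert (Hz : forall x, In x zs -> y x = 0).
  { intros x Hx. apply (Hv x 0%nat). now apply count_occ_In. }
  assert (Hlow : forall x, In x zs -> (0 < ix x)%Z).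
  { intros x Hx. specialize (Hin x Hx) as Hx'. specialize (Hz x Hx).
    assert (Ix := Hix x ltac:(lra) Hz).
    unfold e1 in Hetae1. destruct (Rlt_dec 0 t0) as [T|T].
    - assert (C : eta < theta x).
      { apply (Hcr eta 0%Z al x); try lra. apply Rabs_le. lra. }
      apply Rabs_def2 in Ix. apply lt_IZR. nra.
    - assert (T0 : t0 = 0) by lra. rewrite T0, cos_0, sin_0 in Yal.
      apply (HD al x 0%Z (ix x)); try lra; trivial.
      rewrite Hal, T0. rewrite Rmult_0_l, Rminus_0_r, Rabs_R0. lra. }
  assert (Hup : forall x, In x zs -> (ix x < Z.of_nat (S j))%Z).
  { intros x Hx. specialize (Hin x Hx) as Hx'. specialize (Hz x Hx).
    assert (Ix := Hix x ltac:(lra) Hz).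
    assert (Ej : IZR (Z.of_nat (S j)) * PI = INR j * PI + PI).
    { rewrite <- INR_IZR_INZ, S_INR. ring. }
    unfold e2 in Hetae2. destruct (Rlt_dec gam PI) as [T|T].
    - destruct (Rlt_le_dec (theta x) (IZR (Z.of_nat (S j)) * PI - eta)) as [C|C].
      + apply Rabs_def2 in Ix. apply lt_IZR. nra.
      + exfalso. assert (X : IZR (Z.of_nat (S j)) * PI - eta < theta be); [|lra].
        apply (Hcr _ (Z.of_nat (S j)) x be); try lra. apply Rabs_le. lra.
    - assert (T0 : gam = PI) by lra. rewrite T0, cos_PI, sin_PI in Ybe.
      apply (HD x be (ix x) (Z.of_nat (S j))); try lra; trivial.
      rewrite Hbe, Ej, T0. replace (_ - _) with 0 by ring. rewrite Rabs_R0. lra. }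
  assert (Hsimple : forall x, In x zs -> qy x <> 0).
  { intros x Hx Q. specialize (Hin x Hx) as Hx'. specialize (Hz x Hx).
    assert (Ix := Hix x ltac:(lra) Hz). destruct (HBq x ltac:(lra) Q) as [i Hi].
    apply Rabs_def2 in Ix. apply Rabs_def2 in Hi.
    assert (A1 : IZR i < IZR (ix x)) by nra. assert (A2 : IZR (ix x) < IZR i + 1) by nra.
    rewrite <- plus_IZR in A2. apply lt_IZR in A1. apply lt_IZR in A2. lia. }
  assert (Hnd : NoDup zs).
  { apply (NoDup_count_occ Req_EM_T). intros x.
    destruct (le_lt_dec (mult_in zs x) 1) as [|N]; trivial. exfalso.
    assert (Hx : In x zs) by (apply (count_occ_In Req_EM_T); lia).
    apply (Hsimple x Hx). assert (D := Hv x 1%nat N). simpl in D.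
    assert (Hkx := coef_kpos _ _ _ _ HC x).
    replace (qy x) with (qy x / k x * k x) by (field; lra).
    rewrite <- (is_derive_unique _ _ _ (Hy x)). change (Derive y x = 0) in D. rewrite D. ring. }
  rewrite <- (length_map (fun x => Z.to_nat (ix x)) zs).
  rewrite <- (length_seq j 1).
  apply NoDup_incl_length.
  - apply FinFun.Injective_map_NoDup_in; trivial.
    intros x x' Hx Hx' E.
    assert (E' : ix x = ix x').
    { assert (X1 := Hlow x Hx). assert (X2 := Hlow x' Hx'). lia. }
    specialize (Hin x Hx) as B1. specialize (Hin x' Hx') as B2.
    assert (I1 := Hix x ltac:(lra) (Hz x Hx)). assert (I2 := Hix x' ltac:(lra) (Hz x' Hx')).
    destruct (Rtotal_order x x') as [L|[L|L]]; trivial; exfalso.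
    + assert (X := HD x x' _ _ ltac:(lra) ltac:(lra) L (Hz x Hx) (Hz x' Hx') I1 I2). lia.
    + assert (X := HD x' x _ _ ltac:(lra) ltac:(lra) L (Hz x' Hx') (Hz x Hx) I2 I1). lia.
  - intros i Hi. apply in_map_iff in Hi. destruct Hi as [x [<- Hx]].
    apply in_seq. specialize (Hlow x Hx). specialize (Hup x Hx). lia.
Qed.

(** At points where the angle equals [PI / 2 + i * PI], for [0 <= i <= j], the values of [p sin theta]
alternate in sign and are bounded away from [0]; the function [y] has the same signs there. *)
Lemma many_zeros_near : exists delta, 0 < delta /\ forall y : R -> R,
  (forall x, ex_derive y x) ->
  (forall x, al <= x <= be -> Rabs (y x - p x * sin (theta x)) <= delta) ->
  exists zs, length zs = j /\ has_zeros al be y zs.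
Proof.
  assert (HPI := PI_RGT_0).
  destruct (min_pos p al be) as [pm [Hpm Hpp]]; [lra|auto|auto|].
  exists (pm / 2). split; [lra|]. intros y Hy Hclose.
  assert (Hcy : continuity y).
  { intros x. destruct (Hy x) as [d Hd]. eapply is_derive_continuity_pt, Hd. }
  assert (Hct : continuity theta).
  { intros x. eapply is_derive_continuity_pt, Hth. }
  assert (X : forall i, (i <= j)%nat -> exists s zs, al <= s <= be /\
     theta s = PI / 2 + INR i * PI /\ (sin (theta s) = 1 \/ sin (theta s) = -1) /\
     length zs = i /\ NoDup zs /\ forall z, In z zs -> al < z < s /\ y z = 0).
  { induction i as [|i IH]; intros Hi.
    - destruct (IVT_gen theta al be (PI / 2) Hct) as [s [Hs Es]].
      { assert (Hj := pos_INR j). rewrite Hal, Hbe. 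
        assert (0 <= INR j * PI) by (apply Rmult_le_pos; lra).
        rewrite Rmin_left, Rmax_right by lra. lra. }
      rewrite Rmin_left, Rmax_right in Hs by lra.
      exists s, nil. split; [trivial|split; [|split; [|split; [|split]]]]; trivial.
      + rewrite Es. simpl. ring.
      + left. rewrite Es. apply sin_PI2.
      + constructor.
      + intros z [].
    - destruct (IH ltac:(lia)) as [s [zs [Hs [Es [Ss [Hl [Hnd Hz]]]]]]].
      assert (Hij := le_INR _ _ Hi). rewrite S_INR in Hij.
      assert (Hsb : theta s <= theta be) by (rewrite Es, Hbe; nra).
      destruct (IVT_gen theta s be (theta s + PI) Hct) as [s' [Hs' Es']].
      { rewrite Rmin_left, Rmax_right by lra. rewrite Es, Hbe. split; [lra|]. nra. }
      rewrite Rmin_left, Rmax_right in Hs' by lra.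
      assert (Hss : s < s').
      { destruct (Req_dec s s') as [E|]; [|lra]. rewrite <- E in Es'. lra. }
      assert (Sn : sin (theta s') = - sin (theta s)) by (rewrite Es'; apply neg_sin).
      assert (P1 := Hpp s Hs). assert (P2 := Hpp s' ltac:(lra)).
      assert (C1 := Hclose s Hs). assert (C2 := Hclose s' ltac:(lra)).
      apply Rabs_le_between in C1. apply Rabs_le_between in C2. rewrite Sn in C2.
      assert (Hsg : y s * y s' < 0).
      { destruct Ss as [Ss|Ss]; rewrite Ss in C1, C2; nra. }
      destruct (IVT_gen y s s' 0 Hcy) as [z [Hzz Ez]].
      { unfold Rmin, Rmax. destruct (Rle_dec (y s) (y s')); nra. }
      rewrite Rmin_left, Rmax_right in Hzz by lra.
      assert (Hzs : s < z < s').
      { split.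
        - destruct (Req_dec z s) as [->|]; [rewrite Ez in Hsg|]; lra.
        - destruct (Req_dec z s') as [->|]; [rewrite Ez in Hsg|]; lra. }
      exists s', (z :: zs). split; [lra|split; [|split; [|split; [|split]]]].
      + rewrite Es', Es, S_INR. ring.
      + rewrite Sn. destruct Ss as [->| ->]; [right|left]; ring.
      + simpl. congruence.
      + constructor; trivial. intros E. apply Hz in E. lra.
      + intros v [<-|Hv]. split; [lra|trivial]. apply Hz in Hv. split; [lra|apply Hv]. }
  destruct (X j (le_n j)) as [s [zs [Hs [_ [_ [Hl [Hnd Hz]]]]]]].
  exists zs. split; trivial. split.
  - intros x Hx. apply Hz in Hx. lra.
  - intros x i Hi. assert (Hc := proj1 (NoDup_count_occ Req_EM_T zs) Hnd x).
    destruct i; [|lia]. apply Hz. apply (count_occ_In Req_EM_T). lia.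
Qed.
End Near.

(** * Counting zeros, smooth solutions and finite sums *)

Lemma mult_in_flat_map (mu : R -> nat) (l : list R) (x : R) : NoDup l ->
  (In x l -> mult_in (flat_map (fun x => repeat x (mu x)) l) x = mu x) /\
  (~ In x l -> mult_in (flat_map (fun x => repeat x (mu x)) l) x = 0%nat).
Proof.
  induction 1 as [|y l Hy Hnd [IH1 IH2]]; simpl.
  - split; [intros []|trivial].
  - rewrite count_occ_app. split.
    + intros [<-|Hx].
      * rewrite count_occ_repeat_eq by trivial. rewrite IH2 by trivial. lia.
      * rewrite count_occ_repeat_neq by congruence. now rewrite IH1.
    + intros N. rewrite count_occ_repeat_neq by (intros E; apply N; left; congruence). rewrite IH2 by tauto. trivial.
Qed.

Lemma length_le_of_mult_le (l l' : list R) :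
  (forall x, (mult_in l x <= mult_in l' x)%nat) -> (length l <= length l')%nat.
Proof.
  revert l'. induction l as [|x l IH]; intros l' H; simpl; [lia|].
  assert (Hx : In x l').
  { apply (count_occ_In Req_EM_T). specialize (H x). simpl in H.
    destruct (Req_EM_T x x); [lia|easy]. }
  destruct (in_split x l' Hx) as [l1 [l2 ->]].
  rewrite length_app. simpl. assert (length l <= length (l1 ++ l2))%nat.
  { apply IH. intros y. specialize (H y). rewrite count_occ_app in H |- *. simpl in H.
    destruct (Req_EM_T x y); lia. }
  rewrite length_app in H0. lia.
Qed.

(** A bound on the total multiplicity of every finite family of zeros makes the zero set finite and each
order of vanishing finite; the list of all zeros, repeated according to their orders, is then the
largest such family. *)
Lemma number_of_zeros_of_bound (a b : R) (f : R -> R) (D : nat) :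
  (forall n, Cn a b n f) ->
  (forall zs, has_zeros a b f zs -> (length zs <= D)%nat) ->
  exists N, number_of_zeros f a b N /\ (N <= D)%nat /\
    forall zs, has_zeros a b f zs -> (length zs <= N)%nat.
Proof.
  intros Cf HD.
  assert (X : forall d, (exists l, NoDup l /\ forall x, In x l <-> a < x < b /\ f x = 0) \/
     exists l, length l = d /\ NoDup l /\ forall x, In x l -> a < x < b /\ f x = 0).
  { induction d as [|d IH].
    - right. exists nil. split; [|split]; trivial. constructor. intros x [].
    - destruct IH as [IH|[l [Hl [Hnd Hz]]]]; [now left|].
      destruct (Classical_Prop.classic (exists x, ~ In x l /\ a < x < b /\ f x = 0))
        as [[x [Hx Hfx]]|N].
      + right. exists (x :: l). split; [simpl; congruence|split; [now constructor|]].
        intros y [<-|Hy]; auto.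
      + left. exists l. split; trivial. intros x. split; [apply Hz|].
        intros Hx. apply Classical_Prop.NNPP. intros Hx'. apply N. eauto. }
  destruct (X (S D)) as [[l [Hnd Hl]]|[l [Hl [Hnd Hz]]]].
  2:{ exfalso. assert (length l <= D)%nat; [|lia]. apply HD. split.
      - intros x Hx. now apply Hz.
      - intros x i Hi. assert (Hc := proj1 (NoDup_count_occ Req_EM_T l) Hnd x).
        destruct i; [|lia]. apply Hz. apply (count_occ_In Req_EM_T). lia. }
  assert (Hmu : forall x, exists p, In x l -> vanish p f x /\ Derive_n f p x <> 0).
  { intros x. destruct (in_dec Req_EM_T x l) as [Hx|Hx]; [|exists 0%nat; tauto].
    assert (Y : forall d, (exists p, vanish p f x /\ Derive_n f p x <> 0) \/ vanish d f x).
    { induction d as [|d [IH|IH]]; [right; intros i Hi; lia|now left|].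
      destruct (Req_EM_T (Derive_n f d x) 0) as [E|E]; [right|left; eauto].
      intros i Hi. destruct (Nat.eq_dec i d) as [->|]; trivial. apply IH. lia. }
    destruct (Y (S D)) as [[p Hp]|V]; [eauto|exfalso].
    assert (length (repeat x (S D)) <= D)%nat; [|rewrite repeat_length in H; lia].
    apply HD. split.
    - intros y Hy. apply repeat_spec in Hy. subst y. now apply Hl.
    - intros y. destruct (Req_EM_T x y) as [<-|N].
      + now rewrite count_occ_repeat_eq.
      + rewrite count_occ_repeat_neq by congruence. intros i Hi. lia. }
  apply functional_choice in Hmu. destruct Hmu as [mu Hmu].
  set (zs := flat_map (fun x => repeat x (mu x)) l).
  assert (Hlen : length zs = list_sum (map mu l)).
  { unfold zs. clear. induction l; simpl; trivial. now rewrite length_app, repeat_length, IHl. }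
  assert (Hzs : has_zeros a b f zs).
  { split.
    - intros x Hx. apply in_flat_map in Hx. destruct Hx as [y [Hy Hx]].
      apply repeat_spec in Hx. subst y. now apply Hl.
    - intros x. destruct (mult_in_flat_map mu l x Hnd) as [E1 E2].
      destruct (in_dec Req_EM_T x l) as [Hx|Hx]; unfold zs.
      + rewrite E1 by trivial. now apply Hmu.
      + rewrite E2 by trivial. intros i Hi. lia. }
  exists (list_sum (map mu l)). split; [|split].
  - exists l, mu. split; [trivial|split; [trivial|split; [|trivial]]].
    intros x Hx. destruct (Hmu x Hx) as [H1 H2]. split; [|split]; trivial.
    intros k _. apply (Cn_ex_derive_n a b); trivial. now apply Hl.
  - rewrite <- Hlen. now apply HD.
  - intros zs' [Hin Hv]. rewrite <- Hlen. apply length_le_of_mult_le. intros x.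
    destruct (mult_in_flat_map mu l x Hnd) as [E1 E2].
    destruct (in_dec Req_EM_T x l) as [Hx|Hx]; unfold zs.
    + rewrite E1 by trivial. destruct (Hmu x Hx) as [_ N].
      destruct (le_lt_dec (mult_in zs' x) (mu x)) as [|Lt]; trivial.
      exfalso. apply N. now apply Hv.
    + rewrite E2 by trivial. destruct (mult_in zs' x) as [|d] eqn:E; trivial. exfalso.
      assert (Hxz : In x zs') by (apply (count_occ_In Req_EM_T); lia).
      apply Hx, Hl. split; [now apply Hin|]. apply (Hv x 0%nat). lia.
Qed.

Lemma has_zeros_scal a b c (f h : R -> R) zs :
  (forall x, a < x < b -> h x = f x * c) -> (forall n, Cn a b n f) ->
  has_zeros a b f zs -> has_zeros a b h zs.
Proof.
  intros E Cf [Hin Hv]. split; trivial. intros x.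
  destruct (in_dec Req_EM_T x zs) as [Hx|Hx]; [|now apply vanish_count0].
  apply (vanish_ext a b) with (fun x => f x * c); auto.
  - intros t Ht. now rewrite E.
  - apply (vanish_mult a b); auto. apply Cn_const.
Qed.

Lemma ode_smooth (a b r : R) (k g l u q : R -> R) :
  (forall x, 0 < k x) ->
  (forall n, Cn a b n k) -> (forall n, Cn a b n g) -> (forall n, Cn a b n l) ->
  (forall x, is_derive u x (q x / k x)) ->
  (forall x, is_derive q x ((l x - r * g x) * u x)) ->
  forall n, Cn a b n u /\ Cn a b n q.
Proof.
  intros Hk Ck Cg Cl Hu Hq. induction n as [|n [IHu IHq]]; [now split|]. split; split.
  - intros x _. eexists; apply Hu.
  - apply Cn_ext with (fun x => q x * / k x).
    + intros x _. symmetry. apply is_derive_unique, Hu.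
    + apply Cn_mult; trivial. apply Cn_inv; trivial. intros; apply Rgt_not_eq, Hk.
  - intros x _. eexists; apply Hq.
  - apply Cn_ext with (fun x => (l x - r * g x) * u x).
    + intros x _. symmetry. apply is_derive_unique, Hq.
    + apply Cn_mult; trivial. apply Cn_minus; trivial. apply Cn_mult; trivial. apply Cn_const.
Qed.

Lemma sum_n_m_closed (P : R -> Prop) (f : nat -> R) (m n : nat) :
  P 0 -> (forall s t, P s -> P t -> P (s + t)) ->
  (forall j, (m <= j <= n)%nat -> P (f j)) -> P (sum_n_m f m n).
Proof.
  intros H0 H2 Hf. induction n as [|n IH].
  - destruct m; [rewrite sum_n_n; auto|rewrite sum_n_m_zero; auto; lia].
  - destruct (le_lt_dec m (S n)) as [L|L]; [|rewrite sum_n_m_zero; auto; lia].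
    rewrite sum_n_Sm by trivial. apply H2; auto. apply IH. intros; apply Hf; lia.
Qed.

(** Induction on the number of terms for a relation between two sums of functions; the third hypothesis
stands for functional extensionality. *)
Lemma sum_n_m_rel {T} (P : (T -> R) -> (T -> R) -> Prop) (f d : nat -> T -> R) (m n : nat) :
  P (fun _ => 0) (fun _ => 0) ->
  (forall f f' d d', P f d -> P f' d' -> P (fun x => f x + f' x) (fun x => d x + d' x)) ->
  (forall f f' d d', (forall x, f x = f' x) -> (forall x, d x = d' x) -> P f d -> P f' d') ->
  (forall j, (m <= j <= n)%nat -> P (f j) (d j)) ->
  P (fun x => sum_n_m (fun j => f j x) m n) (fun x => sum_n_m (fun j => d j x) m n).
Proof.
  intros H0 H2 He Hf.
  assert (Z : forall n, (n < m)%nat ->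
    P (fun x => sum_n_m (fun j => f j x) m n) (fun x => sum_n_m (fun j => d j x) m n)).
  { intros n' L. eapply He; [| |exact H0]; intros x; rewrite sum_n_m_zero; auto. }
  induction n as [|n IH].
  - destruct m; [|apply Z; lia].
    eapply He; [| |apply (Hf 0%nat); lia]; intros x; now rewrite sum_n_n.
  - destruct (le_lt_dec m (S n)) as [L|L]; [|now apply Z].
    eapply He; [| |apply H2; [apply IH|apply (Hf (S n)); lia]].
    + intros x. now rewrite sum_n_Sm.
    + intros x. now rewrite sum_n_Sm.
    + intros; apply Hf; lia.
Qed.

Lemma is_derive_sum_n_m (f d : nat -> R -> R) (m n : nat) (x : R) :
  (forall j, (m <= j <= n)%nat -> is_derive (f j) x (d j x)) ->
  is_derive (fun y => sum_n_m (fun j => f j y) m n) x (sum_n_m (fun j => d j x) m n).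
Proof.
  intros H. apply (sum_n_m_rel (fun f d => is_derive f x (d x)) f d m n); trivial.
  - apply (@is_derive_const R_AbsRing R_NormedModule).
  - intros f1 f2 d1 d2. apply (is_derive_plus f1 f2).
  - intros f1 f2 d1 d2 E1 E2 D. rewrite <- E2. now apply is_derive_ext with f1.
Qed.

Lemma sum_n_m_lin (f s t : nat -> R) (c d : R) (m n : nat) :
  (forall j, f j = c * s j + d * t j) ->
  sum_n_m f m n = c * sum_n_m s m n + d * sum_n_m t m n.
Proof.
  intros H.
  rewrite (sum_n_m_ext f (fun j => plus (mult c (s j)) (mult d (t j)))) by exact H.
  rewrite sum_n_m_plus. now rewrite (sum_n_m_mult_l (K := R_Ring) c s), (sum_n_m_mult_l (K := R_Ring) d t).
Qed.

Lemma sum_n_m_scal (f s : nat -> R) (c : R) (m n : nat) :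
  (forall j, (m <= j <= n)%nat -> f j = s j * c) -> sum_n_m f m n = sum_n_m s m n * c.
Proof.
  intros H. rewrite (sum_n_m_ext_loc f (fun j => mult (s j) c)) by exact H.
  apply (sum_n_m_mult_r (K := R_Ring)).
Qed.

Lemma sum_n_m_single (f : nat -> R) (i m n : nat) : (m <= i <= n)%nat ->
  (forall j, (m <= j <= n)%nat -> j <> i -> f j = 0) -> sum_n_m f m n = f i.
Proof.
  revert i. induction n as [|n IH]; intros i Hi H.
  - replace m with 0%nat by lia. replace i with 0%nat by lia. apply sum_n_n.
  - rewrite sum_n_Sm by lia. destruct (Nat.eq_dec i (S n)) as [->|N].
    + assert (sum_n_m f m n = 0).
      { apply (sum_n_m_closed (fun s => s = 0)); auto. intros; lra.
        intros j Hj. apply H; lia. }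
      rewrite H0. apply Rplus_0_l.
    + rewrite (H (S n)) by lia. rewrite (IH i) by (auto with arith; lia || (intros; apply H; lia)).
      apply Rplus_0_r.
Qed.

Lemma sum_n_m_limit (b : nat -> nat -> R) (e : nat -> R) (f : nat -> R -> R) (al be : R) (m n : nat) :
  (forall j, (m <= j <= n)%nat -> is_lim_seq (fun i => b i j) (e j)) ->
  (forall j, (m <= j <= n)%nat -> exists C, forall x, al <= x <= be -> Rabs (f j x) <= C) ->
  forall eps, 0 < eps -> exists i0, forall i, (i0 <= i)%nat -> forall x, al <= x <= be ->
    Rabs (sum_n_m (fun j => b i j * f j x) m n - sum_n_m (fun j => e j * f j x) m n) <= eps.
Proof.
  intros Hb Hf.
  apply (sum_n_m_rel (T := nat * R)
    (fun F E => forall eps, 0 < eps -> exists i0, forall i, (i0 <= i)%nat ->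
       forall x, al <= x <= be -> Rabs (F (i, x) - E (i, x)) <= eps)
    (fun j z => b (fst z) j * f j (snd z)) (fun j z => e j * f j (snd z)) m n).
  - intros eps He. exists 0%nat. intros i _ x _. rewrite Rminus_diag, Rabs_R0. lra.
  - intros F F' E E' H H' eps He.
    destruct (H (eps / 2)) as [i1 H1]; [lra|]. destruct (H' (eps / 2)) as [i2 H2]; [lra|].
    exists (max i1 i2). intros i Hi x Hx.
    specialize (H1 i ltac:(lia) x Hx). specialize (H2 i ltac:(lia) x Hx).
    apply Rabs_le_between in H1. apply Rabs_le_between in H2. apply Rabs_le. lra.
  - intros F F' E E' EF EE H eps He. destruct (H eps He) as [i0 Hi]. exists i0.
    intros i Hii x Hx. rewrite <- EF, <- EE. auto.
  - intros j Hj eps He. destruct (Hf j Hj) as [C HC].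
    assert (HC0 : 0 < Rabs C + 1) by (assert (X := Rabs_pos C); lra).
    assert (Hl := Hb j Hj). apply is_lim_seq_spec in Hl.
    assert (He' : 0 < eps / (Rabs C + 1)) by (apply Rdiv_lt_0_compat; lra).
    destruct (Hl (mkposreal _ He')) as [i0 H0]. exists i0. intros i Hi x Hx. simpl.
    specialize (H0 i Hi). simpl in H0. specialize (HC x Hx).
    replace (b i j * f j x - e j * f j x) with ((b i j - e j) * f j x) by ring.
    rewrite Rabs_mult. replace eps with (eps / (Rabs C + 1) * (Rabs C + 1)) by (field; lra).
    apply Rmult_le_compat; try apply Rabs_pos; try lra.
    assert (X := Rle_abs C). lra.
Qed.

(** * Linear combinations of eigenfunctions *)

Section Combinations.
Variables (k g l : R -> R) (M al be t0 gam : R) (rho : nat -> R) (theta p : nat -> R -> R).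
Hypothesis HC : coefs k g l M.
Hypothesis Hab : al < be.
Hypothesis Ck : forall n, Cn al be n k.
Hypothesis Cg : forall n, Cn al be n g.
Hypothesis Cl : forall n, Cn al be n l.
Hypothesis Ht0 : 0 <= t0 <= PI / 2.
Hypothesis Hgam : PI / 2 <= gam <= PI.
Hypothesis Hrho : forall i j, (1 <= i)%nat -> (i < j)%nat -> rho i < rho j.
Let u j x := p j x * sin (theta j x).
Let q j x := p j x * cos (theta j x).
Hypothesis Hsp : forall j, (1 <= j)%nat ->
    prufer_angle k g l (rho j) (theta j) /\ theta j al = t0 /\
    theta j be = gam + INR (j - 1) * PI /\
    (forall x, 0 < p j x) /\
    (forall x, is_derive (u j) x (q j x / k x)) /\
    (forall x, is_derive (q j) x ((l x - rho j * g x) * u j x)).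

Lemma mode_smooth j : (1 <= j)%nat -> forall n, Cn al be n (u j) /\ Cn al be n (q j).
Proof.
  intros Hj. destruct (Hsp j Hj) as [_ [_ [_ [_ [Hu Hq]]]]].
  apply (ode_smooth al be (rho j) k g l); trivial. apply (coef_kpos _ _ _ _ HC).
Qed.

Lemma mode_continuous j : (1 <= j)%nat ->
  (forall x, continuity_pt (u j) x) /\ (forall x, continuity_pt (q j) x).
Proof.
  intros Hj. destruct (Hsp j Hj) as [_ [_ [_ [_ [Hu Hq]]]]].
  split; intros x; eapply is_derive_continuity_pt; [apply Hu|apply Hq].
Qed.

Lemma mode_left j : (1 <= j)%nat -> u j al * cos t0 = q j al * sin t0.
Proof.
  intros Hj. destruct (Hsp j Hj) as [_ [E _]]. unfold u, q. rewrite E. ring.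
Qed.

Lemma mode_right j : (1 <= j)%nat -> u j be * cos gam = q j be * sin gam.
Proof.
  intros Hj. destruct (Hsp j Hj) as [_ [_ [E _]]]. unfold u, q.
  assert (Z : sin (theta j be - gam) = 0).
  { apply sin_eq_0_IZR. exists (Z.of_nat (j - 1)). rewrite <- INR_IZR_INZ. lra. }
  rewrite sin_minus in Z.
  replace (p j be * sin (theta j be) * cos gam) with
    (p j be * (sin (theta j be) * cos gam - cos (theta j be) * sin gam)
       + p j be * cos (theta j be) * sin gam) by ring.
  rewrite Z. ring.
Qed.

Definition combo (a : nat -> R) (f : nat -> R -> R) (m n : nat) (x : R) : R :=
  sum_n_m (fun j => a j * f j x) m n.

Lemma combo_smooth a f m n : (forall j, (m <= j)%nat -> forall i, Cn al be i (f j)) ->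
  forall i, Cn al be i (combo a f m n).
Proof.
  intros Hf i.
  apply (sum_n_m_rel (fun F _ => Cn al be i F) (fun j x => a j * f j x) (fun j x => 0) m n).
  - apply Cn_const.
  - intros; now apply Cn_plus.
  - intros F F' _ _ E _ H. now apply Cn_ext with F.
  - intros j Hj. apply Cn_mult. apply Cn_const. apply Hf, Hj.
Qed.

Lemma combo_derive a m n x : (1 <= m)%nat ->
  is_derive (combo a u m n) x (combo a q m n x / k x).
Proof.
  intros Hm. unfold Rdiv, combo.
  rewrite <- (sum_n_m_scal (fun j => a j * q j x * / k x)) by auto.
  apply (is_derive_sum_n_m (fun j x => a j * u j x) (fun j x => a j * q j x * / k x)).
  intros j Hj. destruct (Hsp j ltac:(lia)) as [_ [_ [_ [_ [Hu Hq]]]]].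
  rewrite Rmult_assoc. apply (is_derive_scal (u j)). apply Hu.
Qed.

Lemma combo_flux_derive a m n x : (1 <= m)%nat ->
  is_derive (combo a q m n) x
    (l x * combo a u m n x -
       g x * (combo (fun j => a j * (rho j - rho 1%nat)) u m n x + rho 1%nat * combo a u m n x)).
Proof.
  intros Hm.
  replace (_ - _) with ((l x - g x * rho 1%nat) * combo a u m n x +
     - g x * combo (fun j => a j * (rho j - rho 1%nat)) u m n x) by ring.
  unfold combo.
  rewrite <- (sum_n_m_lin (fun j => a j * ((l x - rho j * g x) * u j x))).
  2:{ intros j. ring. }
  apply (is_derive_sum_n_m (fun j x => a j * q j x) (fun j x => a j * ((l x - rho j * g x) * u j x))).
  intros j Hj. destruct (Hsp j ltac:(lia)) as [_ [_ [_ [_ [Hu Hq]]]]].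
  apply (is_derive_scal (q j)). apply Hq.
Qed.

Lemma combo_left a m n : (1 <= m)%nat ->
  combo a u m n al * cos t0 = combo a q m n al * sin t0.
Proof.
  intros Hm. unfold combo.
  rewrite <- (sum_n_m_scal (fun j => a j * u j al * cos t0)) by auto.
  apply sum_n_m_scal. intros j Hj. rewrite !Rmult_assoc. f_equal. apply mode_left. lia.
Qed.

Lemma combo_right a m n : (1 <= m)%nat ->
  combo a u m n be * cos gam = combo a q m n be * sin gam.
Proof.
  intros Hm. unfold combo.
  rewrite <- (sum_n_m_scal (fun j => a j * u j be * cos gam)) by auto.
  apply sum_n_m_scal. intros j Hj. rewrite !Rmult_assoc. f_equal. apply mode_right. lia.
Qed.

Lemma cross_of_parallel c (v w v' w' : R) :
  v * cos c = w * sin c -> v' * cos c = w' * sin c -> v * w' = v' * w.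
Proof.
  intros H H'. assert (E := sin2_cos2 c). unfold Rsqr in E.
  transitivity ((v * w' - v' * w) * (sin c * sin c + cos c * cos c) + v' * w); [rewrite E; ring|].
  replace ((v * w' - v' * w) * (sin c * sin c + cos c * cos c)) with
    (v * sin c * (w' * sin c - v' * cos c) + v' * sin c * (v * cos c - w * sin c)
     + w' * cos c * (v * cos c - w * sin c) - w * cos c * (v' * cos c - w' * sin c)) by ring.
  rewrite H, H'. ring.
Qed.

(** The angle of the first eigenfunction starts at or above [0] and ends at [gam <= PI]; as multiples of
[PI] are crossed upwards only, it stays strictly between [0] and [PI] inside. *)
Lemma first_mode_nonzero x : al < x < be -> u 1%nat x <> 0.
Proof.
  intros Hx. destruct (Hsp 1%nat ltac:(lia)) as [Ht [Ea [Eb [Hp _]]]].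
  assert (HPI := PI_RGT_0). simpl in Eb.
  assert (L : 0 < theta 1%nat x).
  { assert (X := prufer_crossing_multiple k g l M HC _ _ 0 al x Ht ltac:(lra)). lra. }
  assert (U : theta 1%nat x < PI).
  { destruct (Rlt_le_dec (theta 1%nat x) PI) as [|N]; trivial.
    assert (X := prufer_crossing_multiple k g l M HC _ _ 1 x be Ht ltac:(lra)). lra. }
  specialize (Hp x). assert (S := sin_gt_0 _ L U). unfold u. apply Rgt_not_eq. nra.
Qed.

Lemma combo_step a m n zs : (1 <= m)%nat ->
  has_zeros al be (combo a u m n) zs ->
  exists zs', length zs' = length zs /\
    has_zeros al be (combo (fun j => a j * (rho j - rho 1%nat)) u m n) zs'.
Proof.
  intros Hm Hz.
  destruct (Hsp 1%nat ltac:(lia)) as [_ [_ [_ [_ [Hu Hq]]]]].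
  apply (sturm_step al be k g l (u 1%nat) (q 1%nat) (combo a u m n) (combo a q m n) _ (rho 1%nat));
    trivial.
  - apply (coef_kpos _ _ _ _ HC).
  - apply (coef_gpos _ _ _ _ HC).
  - intros i. apply mode_smooth. lia.
  - intros i. apply mode_smooth. lia.
  - apply combo_smooth. intros j Hj i. apply mode_smooth. lia.
  - apply combo_smooth. intros j Hj i. apply mode_smooth. lia.
  - intros x. now apply combo_derive.
  - intros x. now apply combo_flux_derive.
  - apply first_mode_nonzero.
  - apply (cross_of_parallel t0). apply mode_left; lia. now apply combo_left.
  - apply (cross_of_parallel gam). apply mode_right; lia. now apply combo_right.
Qed.

Lemma combo_ext a b f m n x : (forall j, (m <= j <= n)%nat -> a j = b j) ->
  combo a f m n x = combo b f m n x.
Proof. intros H. apply sum_n_m_ext_loc. intros j Hj. now rewrite H. Qed.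

Lemma combo_iterate a m n i zs : (1 <= m)%nat ->
  has_zeros al be (combo a u m n) zs ->
  exists zs', length zs' = length zs /\
    has_zeros al be (combo (fun j => a j * (rho j - rho 1%nat) ^ i) u m n) zs'.
Proof.
  intros Hm Hz.
  assert (S : forall b j, Cn al be j (combo b u m n)).
  { intros b. apply combo_smooth. intros j Hj i'. apply mode_smooth. lia. }
  induction i as [|i [zs' [Hl H]]].
  - exists zs. split; trivial. apply (has_zeros_scal al be 1 (combo a u m n)); trivial.
    intros x _. rewrite Rmult_1_r. apply combo_ext. intros; simpl; ring.
  - destruct (combo_step _ m n zs' Hm H) as [zs2 [Hl2 H2]]. exists zs2. split; [congruence|].
    eapply (has_zeros_scal al be 1); [|apply S|exact H2].
    intros x _. rewrite Rmult_1_r. apply combo_ext. intros; simpl; ring.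
Qed.

Lemma mode_bounded j : (1 <= j)%nat ->
  (exists C, forall x, al <= x <= be -> Rabs (u j x) <= C) /\
  (exists C, forall x, al <= x <= be -> Rabs (q j x) <= C).
Proof.
  intros Hj. destruct (mode_continuous j Hj) as [Hu Hq].
  assert (B : forall f, (forall x, continuity_pt f x) ->
     exists C, forall x, al <= x <= be -> Rabs (f x) <= C).
  { intros f Hf. destruct (continuity_ab_maj (fun x => Rabs (f x)) al be) as [z [Hz _]]; [lra| |].
    - intros x _. apply (continuity_pt_comp f Rabs). apply Hf. apply Rcontinuity_abs.
    - exists (Rabs (f z)). exact Hz. }
  split; auto.
Qed.

(** Only the term of index [N] survives in the limit. Both [u] and [q] are needed, that is, convergence
in [C^1]. *)
Lemma combo_dominant (b lam : nat -> R) (m n N : nat) : (1 <= m)%nat -> (m <= N <= n)%nat ->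
  b N = 1 -> lam N = 1 -> (forall j, (m <= j <= n)%nat -> j <> N -> Rabs (lam j) < 1) ->
  forall eps, 0 < eps -> exists i, forall x, al <= x <= be ->
    Rabs (combo (fun j => b j * lam j ^ i) u m n x - u N x) <= eps /\
    Rabs (combo (fun j => b j * lam j ^ i) q m n x - q N x) <= eps.
Proof.
  intros Hm HN Hb Hl Hlam eps He.
  set (e := fun j => if Nat.eq_dec j N then 1 else 0).
  assert (Hlim : forall j, (m <= j <= n)%nat -> is_lim_seq (fun i => b j * lam j ^ i) (e j)).
  { intros j Hj. unfold e. destruct (Nat.eq_dec j N) as [->|Nj].
    - apply is_lim_seq_ext with (fun _ => 1). intros i. rewrite Hb, Hl, pow1. ring.
      apply is_lim_seq_const.
    - replace 0 with (b j * 0) by ring. apply (is_lim_seq_scal_l (fun i => lam j ^ i) (b j) 0).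
      apply is_lim_seq_geom. auto. }
  assert (Es : forall (f : nat -> R -> R) x, sum_n_m (fun j => e j * f j x) m n = f N x).
  { intros f x. rewrite (sum_n_m_single _ N m n HN).
    2:{ intros j Hj Nj. unfold e. destruct (Nat.eq_dec j N); [easy|ring]. }
    unfold e. destruct (Nat.eq_dec N N); [apply Rmult_1_l|easy]. }
  destruct (sum_n_m_limit (fun i j => b j * lam j ^ i) e u al be m n Hlim) with eps as [i1 H1]; trivial.
  { intros j Hj. apply mode_bounded. lia. }
  destruct (sum_n_m_limit (fun i j => b j * lam j ^ i) e q al be m n Hlim) with eps as [i2 H2]; trivial.
  { intros j Hj. apply mode_bounded. lia. }
  exists (max i1 i2). intros x Hx.
  specialize (H1 (max i1 i2) ltac:(lia) x Hx). specialize (H2 (max i1 i2) ltac:(lia) x Hx).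
  rewrite Es in H1, H2. split; trivial.
Qed.

Variables (m n : nat) (B : nat -> R).
Hypothesis Hm : (1 <= m)%nat.
Hypothesis Hmn : (m <= n)%nat.

Lemma combo_u_smooth a i : Cn al be i (combo a u m n).
Proof. apply combo_smooth. intros j Hj i'. apply mode_smooth. lia. Qed.

Lemma amplitude_continuous j : (1 <= j)%nat -> forall x, continuity_pt (p j) x.
Proof.
  intros Hj. destruct (mode_continuous j Hj) as [Hu Hq].
  destruct (Hsp j Hj) as [Ht [_ [_ [Hp _]]]].
  assert (Hct : forall x, continuity_pt (theta j) x).
  { intros y. eapply is_derive_continuity_pt, Ht. }
  intros x.
  apply (continuity_pt_ext (fun x => u j x * sin (theta j x) + q j x * cos (theta j x))).
  - intros y. unfold u, q. assert (E := sin2_cos2 (theta j y)). unfold Rsqr in E.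
    replace (p j y) with (p j y * (sin (theta j y) * sin (theta j y) +
       cos (theta j y) * cos (theta j y))) at 3 by (rewrite E; ring). ring.
  - apply continuity_pt_plus; apply continuity_pt_mult; auto.
    apply (continuity_pt_comp (theta j) sin); [auto|apply continuity_sin].
    apply (continuity_pt_comp (theta j) cos); [auto|apply continuity_cos].
Qed.

(** With [lam j = (rho j - rho 1) / (rho n - rho 1)], the combination with coefficients
[B j / B n * lam j ^ i] is a multiple of the [i]-th iterate of the operator on the given one, so it
has at least as many zeros, and it is close to [u n]. For [n = 1] this ratio is meaningless, but the
combination is a multiple of the first eigenfunction. *)
Lemma combo_upper zs : B n <> 0 -> has_zeros al be (combo B u m n) zs -> (length zs <= n - 1)%nat.
Proof.
  intros HB Hz.
  destruct (Hsp n ltac:(lia)) as [Ht [Ea [Eb [Hp [Hu Hq]]]]].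
  destruct (few_zeros_near k g l M al be (rho n) t0 gam (theta n) (p n) (n - 1))
    as [d [Hd Hfew]]; trivial.
  { apply amplitude_continuous. lia. }
  destruct (Nat.eq_dec n 1) as [En|En].
  - destruct zs as [|z zs]; [simpl; lia|exfalso].
    destruct Hz as [Hin Hv]. specialize (Hin z ltac:(now left)).
    specialize (Hv z 0%nat). simpl in Hv. destruct (Req_EM_T z z); [|easy].
    specialize (Hv ltac:(lia)). unfold combo in Hv. replace m with n in Hv by lia.
    rewrite sum_n_n in Hv. apply Rmult_integral in Hv. destruct Hv as [Hv|Hv]; [easy|].
    rewrite En in Hv. now apply first_mode_nonzero in Hv.
  - assert (R1 := Hrho 1 n ltac:(lia) ltac:(lia)).
    set (lam := fun j => (rho j - rho 1%nat) / (rho n - rho 1%nat)).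
    destruct (combo_dominant (fun j => B j / B n) lam m n n) with d as [i Hi]; trivial; try lia.
    { field; trivial. }
    { unfold lam. field. lra. }
    { intros j Hj Nj. unfold lam. assert (R2 := Hrho j n ltac:(lia) ltac:(lia)).
      assert (rho 1%nat <= rho j).
      { destruct (Nat.eq_dec j 1) as [->|]; [lra|]. apply Rlt_le, Hrho; lia. }
      rewrite Rabs_pos_eq. apply Rlt_div_l; lra. apply Rdiv_le_0_compat; lra. }
    destruct (combo_iterate B m n i zs Hm Hz) as [zs' [Hl Hz']]. rewrite <- Hl.
    apply (Hfew (combo (fun j => B j / B n * lam j ^ i) u m n)
                (combo (fun j => B j / B n * lam j ^ i) q m n)).
    + intros x. now apply combo_derive.
    + now apply combo_left.
    + now apply combo_right.
    + exact Hi.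
    + eapply (has_zeros_scal al be (/ (B n * (rho n - rho 1%nat) ^ i)));
        [|intros; apply combo_u_smooth|exact Hz'].
      intros x _. unfold combo. apply sum_n_m_scal. intros j _.
      unfold lam, Rdiv. rewrite Rpow_mult_distr, pow_inv. field.
      split; trivial. apply pow_nonzero. lra.
Qed.

(** With [lam j = (rho m - rho 1) / (rho j - rho 1)], the combination with coefficients
[B j / B m * lam j ^ i] is close to [u m], and the [i]-th iterate of the operator takes it to a
multiple of the given combination. *)
Lemma combo_lower : B m <> 0 ->
  exists zs, length zs = (m - 1)%nat /\ has_zeros al be (combo B u m n) zs.
Proof.
  intros HB. destruct (Nat.eq_dec m 1) as [Em|Em].
  { exists nil. split; [simpl; lia|]. split; [intros x []|]. intros x j Hj. simpl in Hj. lia. }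
  destruct (Hsp m Hm) as [Ht [Ea [Eb [Hp [Hu Hq]]]]].
  destruct (many_zeros_near k g l al be (rho m) t0 gam (theta m) (p m) (m - 1))
    as [d [Hd Hmany]]; trivial.
  { apply amplitude_continuous. lia. }
  assert (R1 : forall j, (m <= j)%nat -> rho 1%nat < rho j) by (intros; apply Hrho; lia).
  set (lam := fun j => (rho m - rho 1%nat) / (rho j - rho 1%nat)).
  destruct (combo_dominant (fun j => B j / B m) lam m n m) with d as [i Hi]; trivial; try lia.
  { field; trivial. }
  { unfold lam. field. specialize (R1 m ltac:(lia)). lra. }
  { intros j Hj Nj. unfold lam. assert (R2 := Hrho m j ltac:(lia) ltac:(lia)).
    assert (R3 := R1 m ltac:(lia)).
    rewrite Rabs_pos_eq. apply Rlt_div_l; lra. apply Rdiv_le_0_compat; lra. }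
  destruct (Hmany (combo (fun j => B j / B m * lam j ^ i) u m n)) as [zs [Hl Hz]].
  { intros x. eexists. now apply combo_derive. }
  { intros x Hx. now apply Hi. }
  destruct (combo_iterate _ m n i zs Hm Hz) as [zs' [Hl' Hz']].
  exists zs'. split; [congruence|].
  eapply (has_zeros_scal al be (B m / (rho m - rho 1%nat) ^ i));
    [|intros; apply combo_u_smooth|exact Hz'].
  assert (R3 := R1 m ltac:(lia)).
  intros x _. unfold combo. apply sum_n_m_scal. intros j Hj.
  assert (R2 := R1 j ltac:(lia)).
  unfold lam, Rdiv. rewrite Rpow_mult_distr, pow_inv. field.
  repeat split; trivial; apply pow_nonzero; lra.
Qed.
End Combinations.

Theorem theorem3p2
  (alpha0 beta0 : Rbar) (alpha beta : R)
  (Halphabeta : alpha < beta)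
  (Halpha : in_open alpha0 beta0 alpha) (Hbeta : in_open alpha0 beta0 beta)
  (K G L : R -> R)
  (HK : smooth_on alpha0 beta0 K)
  (HG : smooth_on alpha0 beta0 G)
  (HL : smooth_on alpha0 beta0 L)
  (HKpos : forall x, in_open alpha0 beta0 x -> 0 < K x)
  (HGpos : forall x, in_open alpha0 beta0 x -> 0 < G x)
  (HLpos : forall x, in_open alpha0 beta0 x -> 0 < L x)
  (h H : Rbar) (Hh : Rbar_le 0 h) (HH : Rbar_le 0 H)
  (rho : nat -> R)
  (Hrho : enumerates_eigenvalues alpha beta K G L h H rho)
  (V : nat -> R -> R)
  (HV : forall j, (1 <= j)%nat ->
          is_eigenfunction alpha beta K G L h H (rho j) (V j))
  (m n : nat) (Hm : (1 <= m)%nat) (Hmn : (m <= n)%nat)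
  (A : nat -> R) (HA : A m * A n <> 0) :
  exists N : nat,
    number_of_zeros (fun x => sum_n_m (fun j => A j * V j x) m n) alpha beta N /\
    (N <= n - 1)%nat /\
    (m - 1 <= N)%nat.
Proof.
  destruct (coefs_clamp alpha0 beta0 alpha beta K G L) as [M HC]; trivial.
  set (k := fun x => K (clamp alpha beta x)) in HC.
  set (g := fun x => G (clamp alpha beta x)) in HC.
  set (l := fun x => L (clamp alpha beta x)) in HC.
  assert (Hcl : forall (f : R -> R) x, alpha <= x <= beta -> f (clamp alpha beta x) = f x).
  { intros f x Hx. now rewrite clamp_id. }
  assert (Csm : forall f, smooth_on alpha0 beta0 f ->
     forall i, Cn alpha beta i (fun x => f (clamp alpha beta x))).
  { intros f Hf i. apply Cn_ext with f.
    - intros x Hx. rewrite Hcl; lra.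
    - apply Cn_of_ex_derive_n. intros j x Hx. apply Hf. split.
      + apply Rbar_lt_trans with alpha. apply Halpha. apply Hx.
      + apply Rbar_lt_trans with beta. apply Hx. apply Hbeta. }
  destruct (left_condition_angle h Hh) as [t0 [Ht0 Hleft]].
  destruct (right_condition_angle H HH) as [gam [Hgam Hright]].
  destruct (eigenfunctions_prufer alpha beta K G L k g l M h H t0 gam Halphabeta HC
    (Hcl K) (Hcl G) (Hcl L) Ht0 Hleft Hgam Hright rho V Hrho HV) as [theta [p [c Hsp]]].
  assert (Hinc : forall i j, (1 <= i)%nat -> (i < j)%nat -> rho i < rho j).
  { intros i j Hi Hij. induction Hij as [|j Hij IH].
    - now apply Hrho.
    - eapply Rlt_trans; [exact IH|]. apply Hrho. lia. }
  set (u := fun j x => p j x * sin (theta j x)).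
  set (B := fun j => A j * c j).
  set (Y := fun x => sum_n_m (fun j => A j * V j x) m n).
  assert (HY : forall x, alpha < x < beta -> Y x = combo B u m n x).
  { intros x Hx. apply sum_n_m_ext_loc. intros j Hj.
    destruct (Hsp j ltac:(lia)) as [_ [_ [_ [_ [_ [_ [_ E]]]]]]].
    rewrite E by lra. unfold B, u. symmetry. apply Rmult_assoc. }
  assert (Hsp' : forall j, (1 <= j)%nat ->
    prufer_angle k g l (rho j) (theta j) /\ theta j alpha = t0 /\
    theta j beta = gam + INR (j - 1) * PI /\
    (forall x, 0 < p j x) /\
    (forall x, is_derive (fun x => p j x * sin (theta j x)) x (p j x * cos (theta j x) / k x)) /\
    (forall x, is_derive (fun x => p j x * cos (theta j x)) x
      ((l x - rho j * g x) * (p j x * sin (theta j x))))).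
  { intros j Hj. destruct (Hsp j Hj) as [H1 [H2 [H3 [H4 [H5 [H6 _]]]]]].
    split; [|split; [|split; [|split; [|split]]]]; trivial. }
  assert (HB : forall j, (1 <= j)%nat -> A j <> 0 -> B j <> 0).
  { intros j Hj HAj. destruct (Hsp j Hj) as [_ [_ [_ [_ [_ [_ [Hc _]]]]]]].
    now apply Rmult_integral_contrapositive_currified. }
  assert (HBm : B m <> 0) by (apply HB; [lia|intros E; apply HA; rewrite E; ring]).
  assert (HBn : B n <> 0) by (apply HB; [lia|intros E; apply HA; rewrite E; ring]).
  assert (Cu : forall i, Cn alpha beta i (combo B u m n)).
  { intros i. apply (combo_u_smooth k g l M alpha beta t0 gam rho theta p); trivial; now apply Csm. }
  assert (CY : forall i, Cn alpha beta i Y).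
  { intros i. apply Cn_ext with (combo B u m n); trivial. intros x Hx. now rewrite HY. }
  destruct (number_of_zeros_of_bound alpha beta Y (n - 1)) as [N [HN [HN1 HN2]]]; trivial.
  { intros zs Hz.
    apply (combo_upper k g l M alpha beta t0 gam rho theta p HC) with (m := m) (B := B);
      trivial; try now apply Csm.
    apply (has_zeros_scal alpha beta 1 Y); trivial. intros x Hx. rewrite HY by trivial. symmetry. apply Rmult_1_r. }
  exists N. split; [|split]; trivial.
  destruct (combo_lower k g l M alpha beta t0 gam rho theta p HC) with (m := m) (n := n) (B := B)
    as [zs [Hl Hz]]; trivial; try now apply Csm.
  rewrite <- Hl. apply HN2. apply (has_zeros_scal alpha beta 1 (combo B u m n)); trivial.
  intros x Hx. rewrite HY by trivial. symmetry. apply Rmult_1_r.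
Qed.
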